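(* For $i=1,2$ let $h_i:\mathbb R\to\mathbb R$ be convex with $h_i'(t)\ge 0$ for a.e. $t\in\mathbb R$ and $\operatorname{ess\,lim}_{t\to\infty}h_i'(t)=\alpha_i\in[0,1)$, and set $H_1(p)=-p_1+h_1(p_2)$, $H_2(p)=-p_2+h_2(p_1)$ for $p\in\mathbb R^2$. Let $a=(a_1,a_2)\in\mathbb R^2$ be the (unique) point with $h_1(a_2)=a_1$, $h_2(a_1)=a_2$, and put $\tilde h_1(t)=-a_1+h_1(t+a_2)$, $\tilde h_2(t)=-a_2+h_2(t+a_1)$. Assume that there are vectors $v_0,v_1,v_2\in\mathbb R^2$ such that $(v_0,v_1,v_2)$ is admissible for $(\tilde h_1,\tilde h_2)$ and the slope condition holds for $(\tilde h_1,\tilde h_2)$ and $(v_0,v_1,v_2)$ (both notions are defined in the context). Then there exists a convex function $f\in C^{1,1}(\mathbb R^2)$ such that for all $x\in\mathbb R^2$ $$H_1(Df(x))\begin{cases}\ge0&\text{if }x_1\le0,\\ \le0&\text{if }x_1\ge0,\end{cases}\qquad H_2(Df(x))\begin{cases}\ge0&\text{if }x_2\le0,\\ \le0&\text{if }x_2\ge0,\end{cases}$$ and, for some positive constants $\delta,C$, $$\delta|x|^2-C\le f(x)\le C(|x|^2+1)\quad\text{for all }x\in\mathbb R^2.$$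
   Context: $C^{1,1}(\mathbb R^2)$ denotes the functions that are continuously differentiable on $\mathbb R^2$ with (globally) Lipschitz continuous gradient. $e_1,e_2$ is the standard basis of $\mathbb R^2$. Admissible vectors and slope condition. Let $k_1,k_2:\mathbb R\to\mathbb R$ be convex with $k_i'\ge0$ a.e., $\operatorname{ess\,lim}_{t\to\infty}k_i'(t)\in[0,1)$ and $k_i(0)=0$. A triple $(v_0,v_1,v_2)$ of vectors in $\mathbb R^2$ is admissible for $(k_1,k_2)$ if $v_0\cdot e_1>0$, $v_0\cdot e_2>0$, $v_1\cdot(-e_1)>0$, $v_1\cdot e_2>0$, $v_2\cdot e_1>0$, $v_2\cdot(-e_2)>0$; $\operatorname{ess\,inf}_{t\ge0}v_1\cdot(k_1'(t),1)>0$, $\operatorname{ess\,inf}_{t\le0}v_1\cdot(-1,-k_2'(t))>0$; $\operatorname{ess\,inf}_{t\ge0}v_2\cdot(1,k_2'(t))>0$, $\operatorname{ess\,inf}_{t\le0}v_2\cdot(-k_1'(t),-1)>0$. For such a triple and $\lambda>0$: $x_{PQ}^\lambda$ and $x_{PR}^\lambda$ are the unique points where the line $v_0\cdot x=\lambda$ meets the curves $x_1=k_1(x_2)$ and $x_2=k_2(x_1)$, respectively; with $\lambda_1=v_1\cdot x_{PQ}^\lambda$ and $\lambda_2=v_2\cdot x_{PR}^\lambda$, $x_{QS}^\lambda$ is the unique point in $(-\infty,0]^2$ where the line $v_1\cdot x=\lambda_1$ meets the curve $x_2=k_2(x_1)$, and $x_{RS}^\lambda$ is the unique point in $(-\infty,0]^2$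 where the line $v_2\cdot x=\lambda_2$ meets the curve $x_1=k_1(x_2)$. The slope condition for $(k_1,k_2)$ and $(v_0,v_1,v_2)$ is: there exists a constant $0<\gamma<1$ such that for each $\lambda>0$ the slope of the line passing through $x_{QS}^\lambda$ and $x_{RS}^\lambda$ lies in $[-1/\gamma,-\gamma]$. *)

(* Defs.v *)
From mathcomp Require Import all_boot all_order all_algebra.
From mathcomp Require Import all_classical all_reals all_analysis.
From mathcomp Require Import ess_sup_inf.

Set Implicit Arguments.
Unset Strict Implicit.
Unset Printing Implicit Defensive.

Import Order.TTheory GRing.Theory Num.Theory.
Import numFieldNormedType.Exports.

Local Open Scope classical_set_scope.
Local Open Scope ring_scope.

Definition vec2 (R : realType) (a b : R) : 'rV[R]_2 :=
  \row_(i < 2) if i == 0 then a else b.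

(* Euclidean inner product; |x|^2 is [dot x x], whereas the library norm on
   row vectors is the max norm *)
Definition dot (R : realType) (u v : 'rV[R]_2) : R := (u *m v^T) 0 0.

Definition e1 (R : realType) : 'rV[R]_2 := delta_mx 0 0.
Definition e2 (R : realType) : 'rV[R]_2 := delta_mx 0 1.
Arguments e1 {R}.
Arguments e2 {R}.

Definition grad (R : realType) (f : 'rV[R]_2 -> R) (x : 'rV[R]_2) : 'rV[R]_2 :=
  \row_(i < 2) 'D_(delta_mx 0 i) f x.

Definition C11 (R : realType) (f : 'rV[R]_2 -> R) : Prop :=
  [/\ forall x, differentiable f x, continuous (grad f) & lipschitz (grad f)].

(* ess lim_{t -> +oo} g t = l *)
Definition ess_lim_pinfty (R : realType) (g : R -> R) (l : R) : Prop :=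
  forall e : R, 0 < e -> exists M : R,
    {ae @lebesgue_measure R, forall t, M < t -> `|g t - l| < e}.

(* ess inf over [0, +oo) and over (-oo, 0] *)
Definition ess_inf_nneg (R : realType) (g : R -> R) : \bar R :=
  ess_infr (mrestr (@lebesgue_measure R) (measurable_itv `[0, +oo[)) g.
Definition ess_inf_npos (R : realType) (g : R -> R) : \bar R :=
  ess_infr (mrestr (@lebesgue_measure R) (measurable_itv `]-oo, 0])) g.

(* [derive1 h] is a junk value where [h] is not derivable, so "h' >= 0 a.e." is
   written with derivability *)
Definition convex_slope (R : realType) (h : R -> R) (alpha : R) : Prop :=
  [/\ convex_function [set: R^o] h,
      {ae @lebesgue_measure R, forall t, derivable h t 1 /\ 0 <= derive1 h t},
      ess_lim_pinfty (derive1 h) alpha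
    & 0 <= alpha < 1].

Definition H1 (R : realType) (h1 : R -> R) (p : 'rV[R]_2) : R :=
  - p 0 0 + h1 (p 0 1).
Definition H2 (R : realType) (h2 : R -> R) (p : 'rV[R]_2) : R :=
  - p 0 1 + h2 (p 0 0).

Definition htilde1 (R : realType) (h1 : R -> R) (a : 'rV[R]_2) (t : R) : R :=
  - a 0 0 + h1 (t + a 0 1).
Definition htilde2 (R : realType) (h2 : R -> R) (a : 'rV[R]_2) (t : R) : R :=
  - a 0 1 + h2 (t + a 0 0).

Definition admissible (R : realType) (k1 k2 : R -> R)
    (v0 v1 v2 : 'rV[R]_2) : Prop :=
  [/\ [/\ 0 < dot v0 e1, 0 < dot v0 e2,
          0 < dot v1 (- e1) & 0 < dot v1 e2],
      0 < dot v2 e1 /\ 0 < dot v2 (- e2),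
      (0 < ess_inf_nneg (fun t => dot v1 (vec2 (derive1 k1 t) 1)))%E /\
      (0 < ess_inf_npos (fun t => dot v1 (vec2 (-1) (- derive1 k2 t))))%E
    & (0 < ess_inf_nneg (fun t => dot v2 (vec2 1 (derive1 k2 t))))%E /\
      (0 < ess_inf_npos (fun t => dot v2 (vec2 (- derive1 k1 t) (-1))))%E].

(* the curves x_1 = k(x_2) and x_2 = k(x_1) *)
Definition on_curve1 (R : realType) (k : R -> R) (x : 'rV[R]_2) : Prop :=
  x 0 0 = k (x 0 1).
Definition on_curve2 (R : realType) (k : R -> R) (x : 'rV[R]_2) : Prop :=
  x 0 1 = k (x 0 0).

Definition nonpos_quadrant (R : realType) (x : 'rV[R]_2) : Prop :=
  x 0 0 <= 0 /\ x 0 1 <= 0.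

Definition is_xPQ (R : realType) (k1 : R -> R) (v0 : 'rV[R]_2) (lambda : R)
    (x : 'rV[R]_2) : Prop :=
  dot v0 x = lambda /\ on_curve1 k1 x.
Definition is_xPR (R : realType) (k2 : R -> R) (v0 : 'rV[R]_2) (lambda : R)
    (x : 'rV[R]_2) : Prop :=
  dot v0 x = lambda /\ on_curve2 k2 x.
Definition is_xQS (R : realType) (k2 : R -> R) (v1 : 'rV[R]_2) (lambda1 : R)
    (x : 'rV[R]_2) : Prop :=
  [/\ nonpos_quadrant x, dot v1 x = lambda1 & on_curve2 k2 x].
Definition is_xRS (R : realType) (k1 : R -> R) (v2 : 'rV[R]_2) (lambda2 : R)
    (x : 'rV[R]_2) : Prop :=
  [/\ nonpos_quadrant x, dot v2 x = lambda2 & on_curve1 k1 x].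

(* 0 when the line is vertical or undefined (x / 0 = 0); since
   0 \notin [-1/gamma, -gamma], such lines violate the condition below *)
Definition slope (R : realType) (x y : 'rV[R]_2) : R :=
  (y 0 1 - x 0 1) / (y 0 0 - x 0 0).

(* For k1, k2 convex and nondecreasing, null at 0, with slopes at +oo below 1,
   and an admissible triple, the four points exist and are unique for each
   lambda > 0, so quantifying over them amounts to naming them. *)
Definition slope_condition (R : realType) (k1 k2 : R -> R)
    (v0 v1 v2 : 'rV[R]_2) : Prop :=
  exists gamma : R, 0 < gamma < 1 /\
    forall lambda : R, 0 < lambda ->
    forall xPQ xPR xQS xRS : 'rV[R]_2,
      is_xPQ k1 v0 lambda xPQ -> is_xPR k2 v0 lambda xPR ->
      is_xQS k2 v1 (dot v1 xPQ) xQS -> is_xRS k1 v2 (dot v2 xPR) xRS ->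
      - 1 / gamma <= slope xQS xRS <= - gamma.

(* Main.v *)
From HB Require Import structures.
Require Import Defs.
From mathcomp Require Import all_boot all_order all_algebra.
From mathcomp Require Import all_classical all_reals all_analysis.
From mathcomp Require Import ess_sup_inf ring lra.

Set Implicit Arguments.
Unset Strict Implicit.
Unset Printing Implicit Defensive.

Import Order.TTheory GRing.Theory Num.Theory.
Import numFieldNormedType.Exports.

Local Open Scope classical_set_scope.
Local Open Scope ring_scope.

(* Put k_i := htilde_i.  It suffices to find a strongly convex function E with
   quadratic growth such that, for each y, x |-> E (x, y) is minimal exactly at
   x = k1 y and, for each x, y |-> E (x, y) is minimal exactly at y = k2 x:
   the Legendre transform of E is then C^{1,1}, its gradient at x is the
   maximizer p of <x, p> - E p, and comparing p with (k1 p_2, p_2) and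
   (p_1, k2 p_1) gives the sign conditions.

   The function E is phi^2 + kap^2 |p|^2, where phi is a maximum of five convex
   functions of one linear form each, with forms v0, v1, v2, -(1, g) and -(g, 1).
   The first function is v0.p itself; the others are adjusted so that
   neighbouring pieces agree along the four half-curves.  They are convex,
   because along each half-curve the outer piece, read as a function of the
   parameter, is convex and its linear form is concave.  Replacing the fourth
   side of the level polygon by two sides with the fixed normals -(1, g) and
   -(g, 1), g being the constant of the slope condition, is what makes phi
   convex: a side through xQS and xRS would turn with the level. *)

(** * Inner product and max norm on the plane *)

Lemma dotE (R : realType) (u v : 'rV[R]_2) :
  dot u v = u 0 0 * v 0 0 + u 0 1 * v 0 1.
Proof.
rewrite /dot mxE big_ord_recl big_ord1 !mxE.
by have -> : lift ord0 ord0 = 1 :> 'I_2 by apply/val_inj.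
Qed.

Lemma row2_norm (R : realType) (p : 'rV[R]_2) :
  `|p| = Num.max `|p 0 0| `|p 0 1|.
Proof.
rewrite /Num.norm /= mx_normrE; apply/le_anti/andP; split.
  apply/bigmax_leP; split=> [|[i j] _]; first by rewrite le_max normr_ge0.
  rewrite ord1 /=; case: j => [[|[|//]] j2]; rewrite le_max.
  - by rewrite (_ : Ordinal j2 = 0) ?lexx//; apply/val_inj.
  - by rewrite (_ : Ordinal j2 = 1) ?lexx ?orbT//; apply/val_inj.
rewrite ge_max; apply/andP; split.
- exact: (le_bigmax _ (fun ij => `|p ij.1 ij.2|) (0, 0)).
- exact: (le_bigmax _ (fun ij => `|p ij.1 ij.2|) (0, 1)).
Qed.

Lemma mulr_self_norm (R : realType) (u : R) : u * u = `|u| * `|u|.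
Proof. by rewrite -normrM ger0_norm -?expr2 ?sqr_ge0. Qed.

Lemma dot_self_le (R : realType) (p : 'rV[R]_2) : dot p p <= 2 * `|p| * `|p|.
Proof.
rewrite dotE row2_norm (mulr_self_norm (p 0 0)) (mulr_self_norm (p 0 1)).
have := normr_ge0 (p 0 0); have := normr_ge0 (p 0 1).
by case: (leP `|p 0 0| `|p 0 1|) => ?; nra.
Qed.

Lemma norm_sq_le_dot (R : realType) (p : 'rV[R]_2) : `|p| * `|p| <= dot p p.
Proof.
rewrite dotE row2_norm (mulr_self_norm (p 0 0)) (mulr_self_norm (p 0 1)).
have := normr_ge0 (p 0 0); have := normr_ge0 (p 0 1).
by case: (leP `|p 0 0| `|p 0 1|) => ?; nra.
Qed.

Lemma dot_self_ge0 (R : realType) (p : 'rV[R]_2) : 0 <= dot p p.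
Proof. by rewrite dotE addr_ge0 // -expr2 sqr_ge0. Qed.

Lemma dot_le_norm (R : realType) (x p : 'rV[R]_2) : dot x p <= 2 * `|x| * `|p|.
Proof.
have xp i : x 0 i * p 0 i <= `|x| * `|p|.
  have le_norm (q : 'rV[R]_2) : `|q 0 i| <= `|q|.
    rewrite row2_norm le_max; case: i => [[|[|//]] i2].
    - by rewrite (_ : Ordinal i2 = 0) ?lexx//; apply/val_inj.
    - by rewrite (_ : Ordinal i2 = 1) ?lexx ?orbT//; apply/val_inj.
  by rewrite (le_trans (ler_norm _))// normrM ler_pM.
rewrite dotE -mulrA mulr_natl mulr2n; exact: lerD.
Qed.

(** * Continuity and differentiability from explicit bounds *)

Lemma lipschitz_bound_continuous (R : realType) (V W : normedModType R)
    (F : V -> W) (L : R) :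
  (forall x y, `|F x - F y| <= L * `|x - y|) -> continuous F.
Proof.
move=> FL t; apply/cvgrPdist_le => e e0.
(* [L] may be zero or negative, so the radius divides by this positive upper bound of it. *)
have L1 : 0 < `|L| + 1 by have := normr_ge0 L; lra.
near=> s.
apply: le_trans (FL _ _) _.
have : `|t - s| <= e / (`|L| + 1).
  by near: s; apply: cvgr_dist_le; [exact: cvg_id | rewrite divr_gt0].
rewrite ler_pdivlMr//; apply: le_trans.
rewrite mulrC ler_wpM2l//; have := ler_norm L; lra.
Unshelve. all: by end_near. Qed.

(** [diff_locallyP] speaks of the chosen differential; uniqueness of the linear part identifies it
    with [df], and the expansion then is the criterion itself. *)
Lemma differentiable_littleo (R : numFieldType) (V W : normedModType R)
    (f : V -> W) (df : {linear V -> W}) (x : V) :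
  continuous df -> f \o shift x = cst (f x) + df +o_ 0 id ->
  differentiable f x /\ 'd f x = df :> (V -> W).
Proof.
move=> dfc fo; have dE := diff_unique dfc fo.
by split=> //; apply/diff_locallyP; rewrite dE.
Qed.

Section quadratic_expansion.
Variables (R : realType) (u : 'rV[R]_2).

Definition dotl (h : 'rV[R]_2) : R := dot u h.

Fact dotl_linear : linear dotl.
Proof. by move=> a x y; rewrite /dotl !dotE !mxE /GRing.scale /=; ring. Qed.

HB.instance Definition _ := GRing.isLinear.Build R 'rV[R]_2 R _ dotl dotl_linear.

Lemma dotl_continuous : continuous dotl.
Proof.
have -> : dotl = fun h => u 0 0 * h 0 0 + u 0 1 * h 0 1.
  by apply/funext => h; exact: dotE.
move=> x; have cc j : (fun h : 'rV[R]_2 => h 0 j) @ x --> x 0 j by apply: coord_continuous.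
exact: cvgD (cvgMl_tmp (a := u 0 0) (cc 0)) (cvgMl_tmp (a := u 0 1) (cc 1)).

Qed.

(** A remainder of order [dot h h] is little-o of [h]; the basis vectors then read off the
    gradient. *)
Lemma quadratic_expansion_diff (f : 'rV[R]_2 -> R) (x : 'rV[R]_2) (K : R) :
  (forall h, `|f (h + x) - f x - dot u h| <= K * dot h h) ->
  differentiable f x /\ grad f x = u.
Proof.
move=> fK.
(* The hypothesis at the unit vector e_1 fixes the sign of [K]. *)
have K0 : 0 <= K.
  have := le_trans (normr_ge0 _) (fK (delta_mx 0 0)).
  by rewrite dotE !mxE /= !(mulr0,mul0r,mulr1,addr0).
have [|df dE] := @differentiable_littleo R _ _ f dotl x dotl_continuous.
  apply/eqaddoP => e e0.
  near=> h.
  rewrite /= !fctE /= opprD addrA; apply: le_trans (fK h) _.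
  have := dot_self_le h.
  move=> /(ler_wpM2l K0) /le_trans; apply.
  rewrite !mulrA; apply: ler_wpM2r => //.
  have : `|h| < e / (2 * K + 1).
    near: h; apply/(@nbhs_norm0P R 'rV[R]_2).
    by exists (e / (2 * K + 1)) => //=; rewrite divr_gt0//; lra.
  rewrite ltr_pdivlMr; last by lra.
  have := normr_ge0 h; nra.
split=> //.
apply/rowP => i; rewrite mxE deriveE// dE [LHS]dotE !mxE /=.
by case: i => [[|[|//]] i2] /=; rewrite ?(mulr1,mulr0,addr0,add0r); congr (u _ _); apply/val_inj.
Unshelve. all: by end_near. Qed.

End quadratic_expansion.

(** * Legendre transform of a strongly convex function on the plane *)

Lemma dotC (R : realType) (u v : 'rV[R]_2) : dot u v = dot v u.
Proof. by rewrite !dotE; ring. Qed.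

Section legendre.
Variables (R : realType) (phi : 'rV[R]_2 -> R) (delta C : R).
Hypotheses (delta0 : 0 < delta) (C0 : 0 < C) (phi_cont : continuous phi).
Hypothesis phi_strong : forall p q, phi (2^-1 *: (p + q)) <=
  (phi p + phi q) / 2 - delta / 4 * dot (p - q) (p - q).
Hypothesis phi_bounds : forall p, delta * dot p p <= phi p <= C * dot p p.

(** Outside the ball of radius [r] the quadratic lower bound makes the objective nonpositive, while
    it vanishes at the origin. A maximum over the compact ball is therefore global. *)
Lemma legendre_maximizer x :
  exists P, forall p, dot x p - phi p <= dot x P - phi P.
Proof.
pose r := 2 * `|x| / delta.
have r0 : 0 <= r by rewrite divr_ge0 ?mulr_ge0 // ltW.
pose A := [set p : 'rV[R]_2 | `|p| <= r].
have phi0 : phi 0 = 0.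
  by have := phi_bounds 0; rewrite dotE !mxE !(mulr0, addr0); lra.
have A0 : A 0 by rewrite /A /= normr0.
have Acompact : compact A.
  apply: bounded_closed_compact.
    exists r; split; first by rewrite num_real.
    by move=> M rM p /= pr; rewrite (le_trans pr) // ltW.
  rewrite (_ : A = (fun p : 'rV[R]_2 => `|p|) @^-1` [set t | t <= r]) //.
  by apply: closed_comp; [move=> p _; exact: norm_continuous | exact: closed_le].
have [|||P PA Pmax] := @EVT_max_rV R 2 (fun p => dot x p - phi p) A.
- by exists 0.
- exact: Acompact.
- apply: continuous_subspaceT => p.
  exact: cvgB (@dotl_continuous R x p) (@phi_cont p).
exists P => p; have [pA|pA] := leP `|p| r; first by apply: Pmax; rewrite inE.
apply: le_trans (Pmax 0 _); last by rewrite inE.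
have -> : dot x 0 = 0 by rewrite dotE !mxE !mulr0 addr0.
rewrite phi0 subr0; have /andP[phip _] := phi_bounds p.
move: pA; rewrite /r ltr_pdivrMr // => /ltW /(ler_wpM2r (normr_ge0 p)) xp.
have := ler_wpM2l (ltW delta0) (norm_sq_le_dot p).
have := dot_le_norm x p; lra.
Qed.

(** A chosen maximizer; [legendre_expansion] shows it to be the gradient of the transform. *)
Definition legendre_grad x := projT1 (cid (legendre_maximizer x)).
Local Notation P := legendre_grad.

Definition legendre x := dot x (P x) - phi (P x).

Lemma legendre_ge x p : dot x p - phi p <= legendre x.
Proof. exact: (projT2 (cid (legendre_maximizer x))). Qed.

(** Compare [P x] with the midpoint of [p] and [P x]: the gain [delta / 4] of the midpoint
    inequality doubles once half of [legendre x] is cancelled. *)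
Lemma legendre_strong x p :
  dot x p - phi p <= legendre x - delta / 2 * dot (p - P x) (p - P x).
Proof.
have := legendre_ge x (2^-1 *: (p + P x)).
have := phi_strong p (P x); rewrite /legendre.
have -> : dot x (2^-1 *: (p + P x)) = (dot x p + dot x (P x)) / 2.
  by rewrite !dotE !mxE; field.
lra.
Qed.

(** Strong maximality at [x] and at [y], each tested with the maximizer of the other, adds up to
    strong monotonicity of [P]. *)
Lemma legendre_grad_lip x y :
  delta * dot (P x - P y) (P x - P y) <= dot (x - y) (P x - P y).
Proof.
have := legendre_strong x (P y); have := legendre_strong y (P x).
rewrite /legendre !dotE !mxE; lra.
Qed.

Lemma legendre_grad_lip_norm x y : `|P x - P y| <= 2 / delta * `|x - y|.
Proof.
have [->|Pxy] := eqVneq (P x - P y) 0.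
  by rewrite normr0 mulr_ge0 // divr_ge0 // ltW.
have N0 : 0 < `|P x - P y| by rewrite normr_gt0.
rewrite mulrAC ler_pdivlMr // mulrC -(ler_pM2r N0).
have := ler_wpM2l (ltW delta0) (norm_sq_le_dot (P x - P y)).
have := legendre_grad_lip x y; have := dot_le_norm (x - y) (P x - P y); lra.
Qed.

(** From below, [P x] is a competitor at [h + x]. From above, [legendre_strong] leaves
    [dot h (q - P x)] minus [delta / 2] times the square of [q - P x], and completing the square
    bounds this. *)
Lemma legendre_expansion x h :
  `|legendre (h + x) - legendre x - dot (P x) h| <= (2 * delta)^-1 * dot h h.
Proof.
rewrite ger0_norm; last first.
  by have := legendre_ge (h + x) (P x); rewrite /legendre !dotE !mxE; lra.
have := legendre_strong x (P (h + x)).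
rewrite [legendre (h + x)]/legendre; set q := P (h + x).
have : 0 <= (2 * delta)^-1 * dot (h - delta *: (q - P x)) (h - delta *: (q - P x)).
  rewrite mulr_ge0 ?invr_ge0 ?mulr_ge0 //; first exact: ltW.
  exact: dot_self_ge0.
have -> : (2 * delta)^-1 * dot (h - delta *: (q - P x)) (h - delta *: (q - P x)) =
    (2 * delta)^-1 * dot h h - dot h q + dot h (P x) + delta / 2 * dot (q - P x) (q - P x).
  by rewrite !dotE !mxE; field; rewrite gt_eqF.
have -> : dot (h + x) q = dot h q + dot x q by rewrite !dotE !mxE; ring.
rewrite (dotC (P x) h); lra.
Qed.

Lemma legendre_convex : convex_function [set: 'rV[R]_2] legendre.
Proof.
move=> t x y _ _; rewrite convRE.
have -> : conv t x y = t%:num *: x + (1 - t%:num) *: y by [].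
rewrite [leLHS]/legendre; set p := P _.
have t0 : 0 <= t%:num by []. have t1 : 0 <= 1 - t%:num by rewrite subr_ge0.
have := ler_wpM2l t0 (legendre_ge x p); have := ler_wpM2l t1 (legendre_ge y p).
rewrite !dotE !mxE /unstable.onem; lra.
Qed.

Lemma legendre_le x : legendre x <= (4 * delta)^-1 * dot x x.
Proof.
have /andP[+ _] := phi_bounds (P x); rewrite /legendre.
have : 0 <= (4 * delta)^-1 * dot (x - (2 * delta) *: P x) (x - (2 * delta) *: P x).
  rewrite mulr_ge0 ?invr_ge0 ?mulr_ge0 //; first exact: ltW.
  exact: dot_self_ge0.
have -> : (4 * delta)^-1 * dot (x - (2 * delta) *: P x) (x - (2 * delta) *: P x) =
    (4 * delta)^-1 * dot x x - dot x (P x) + delta * dot (P x) (P x).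
  by rewrite !dotE !mxE; field; rewrite gt_eqF.
lra.
Qed.

Lemma legendre_coercive x : (4 * C)^-1 * dot x x <= legendre x.
Proof.
(* This point maximizes [dot x p - C * dot p p]. *)
apply: le_trans (legendre_ge x ((2 * C)^-1 *: x)).
have /andP[_] := phi_bounds ((2 * C)^-1 *: x).
have -> : C * dot ((2 * C)^-1 *: x) ((2 * C)^-1 *: x) = (4 * C)^-1 * dot x x.
  by rewrite !dotE !mxE; field; rewrite gt_eqF.
have -> : dot x ((2 * C)^-1 *: x) = 2 * ((4 * C)^-1 * dot x x).
  by rewrite !dotE !mxE; field; rewrite gt_eqF.
lra.
Qed.

End legendre.

(** * Slopes of convex functions and almost everywhere derivatives *)

Definition convex1 (R : realType) (f : R -> R) : Prop :=
  forall w x y, 0 <= w <= 1 -> f (w * x + (1 - w) * y) <= w * f x + (1 - w) * f y.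

Lemma convex_function_convex1 (R : realType) (h : R -> R) :
  convex_function [set: R^o] h -> convex1 h.
Proof.
move=> hc w x y /andP[w0 w1].
have := hc (Itv01 w0 w1) x y; rewrite !inE => /(_ I I).
by rewrite !convRE /=.
Qed.

(** Chord slopes increase; cleared of denominators, the inequality also covers coinciding points. *)
Lemma convex1_chord (R : realType) (f : R -> R) (x y z : R) : convex1 f ->
  x <= y -> y <= z -> (f y - f x) * (z - y) <= (f z - f y) * (y - x).
Proof.
move=> fc xy yz; have [xz|zx] := ltP x z; last first.
  have -> : y = x by lra.
  have -> : z = x by lra.
  by rewrite !subrr.
have zx0 : z - x != 0 by rewrite subr_eq0 gt_eqF.
have w01 : 0 <= (z - y) / (z - x) <= 1.
  rewrite divr_ge0 ?subr_ge0 ?(ltW xz)//=.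
  by rewrite ler_pdivrMr ?subr_gt0// mul1r; lra.
have := fc _ x z w01.
have -> : (z - y) / (z - x) * x + (1 - (z - y) / (z - x)) * z = y by field.
have -> : (z - y) / (z - x) * f x + (1 - (z - y) / (z - x)) * f z =
   ((z - y) * f x + (y - x) * f z) / (z - x) by field.
by rewrite ler_pdivlMr ?subr_gt0//; lra.
Qed.

Lemma derive1_ge (R : realType) (f : R -> R) (u l : R) : derivable f u 1 ->
  (\forall h \near 0^', l <= h^-1 * (f (h + u) - f u)) -> l <= derive1 f u.
Proof.
move=> fu hl; rewrite /derive1; apply: limr_ge; last exact: hl.
move: fu; rewrite /derivable.
set F := (X in cvg (X @ _)); set G := (X in _ -> cvg (X @ _)).
(* [derivable] writes the increment as [h *: 1], [derive1] as [h]. *)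
suff -> : F = G by [].
by apply/funext => h; rewrite /F /G /= /GRing.scale /= mulr1.
Qed.

Lemma derive1_le (R : realType) (f : R -> R) (u l : R) : derivable f u 1 ->
  (\forall h \near 0^', h^-1 * (f (h + u) - f u) <= l) -> derive1 f u <= l.
Proof.
move=> fu hl; rewrite /derive1; apply: limr_le; last exact: hl.
move: fu; rewrite /derivable.
set F := (X in cvg (X @ _)); set G := (X in _ -> cvg (X @ _)).
suff -> : F = G by [].
by apply/funext => h; rewrite /F /G /= /GRing.scale /= mulr1.
Qed.

(** For [h] smaller than [u - t] both [u] and [h + u] lie to the right of [t], so the difference
    quotients at [u] dominate the chord slope over [[s, t]], whatever the sign of [h]. *)
Lemma convex1_slope_le_derive (R : realType) (f : R -> R) (s t u : R) :
  convex1 f -> derivable f u 1 -> s < t -> t < u ->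
  f t - f s <= derive1 f u * (t - s).
Proof.
move=> fc fu st tu; rewrite -ler_pdivrMr ?subr_gt0//.
apply: derive1_ge => //; near=> h.
have h0 : h != 0 by near: h; exact: nbhs_dnbhs_neq.
have hu : `|h| < u - t by near: h; apply: dnbhs0_lt; rewrite subr_gt0.
rewrite ler_pdivrMr ?subr_gt0// mulrAC -mulrA mulrC.
have [hneg|hpos|/eqP] := ltgtP h 0; last by rewrite (negbTE h0).
- have th : t < h + u by move: hu; rewrite ltr0_norm//; lra.
  have c1 := convex1_chord fc (ltW st) (ltW th).
  have c2 := @convex1_chord _ f t (h + u) u fc (ltW th).
  have {}c2 : (f (h + u) - f t) * (u - (h + u)) <= (f u - f (h + u)) * (h + u - t).
    by apply: c2; lra.
  rewrite ler_ndivlMr//.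
  have thp : 0 < h + u - t by lra.
  have stp : 0 < t - s by lra.
  rewrite -(ler_pM2r thp).
  have := ler_wpM2r (ltW stp) c2.
  have hn : 0 <= - h by lra.
  have := ler_wpM2r hn c1; lra.
- have th : u < h + u by lra.
  have c1 := convex1_chord fc (ltW st) (ltW tu).
  have c2 := convex1_chord fc (ltW tu) (ltW th).
  rewrite ler_pdivlMr//.
  have thp : 0 < u - t by lra.
  have stp : 0 < t - s by lra.
  rewrite -(ler_pM2r thp).
  have := ler_wpM2r (ltW stp) c2.
  have := ler_wpM2r (ltW hpos) c1; lra.
Unshelve. all: by end_near. Qed.

Lemma convex1_opp (R : realType) (f : R -> R) : convex1 f -> convex1 (fun t => f (- t)).
Proof.
by move=> fc w x y w01; rewrite opprD -!mulrN; exact: fc.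
Qed.

Lemma convex1_derive_le_slope (R : realType) (f : R -> R) (s t u : R) :
  convex1 f -> derivable f u 1 -> u < s -> s < t ->
  derive1 f u * (t - s) <= f t - f s.
Proof.
move=> fc fu us st; rewrite -ler_pdivlMr ?subr_gt0//.
apply: derive1_le => //; near=> h.
have h0 : h != 0 by near: h; exact: nbhs_dnbhs_neq.
have hu : `|h| < s - u by near: h; apply: dnbhs0_lt; rewrite subr_gt0.
rewrite ler_pdivlMr ?subr_gt0// -mulrA mulrC.
have stp : 0 <= t - s by lra.
have [hneg|hpos|/eqP] := ltgtP h 0; last by rewrite (negbTE h0).
- have th : h + u < u by lra.
  have c1 := convex1_chord fc (ltW th) (ltW us).
  have c2 := convex1_chord fc (ltW us) (ltW st).
  rewrite ler_ndivrMr//.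
  have thp : 0 < s - u by lra.
  rewrite -(ler_pM2r thp).
  have := ler_wpM2r stp c1.
  have hn : 0 <= - h by lra.
  have := ler_wpM2r hn c2; lra.
- have th : h + u < s by move: hu; rewrite gtr0_norm//; lra.
  have uh : u <= h + u by lra.
  have c1 := convex1_chord fc uh (ltW th).
  have c2 := convex1_chord fc (ltW th) (ltW st).
  rewrite ler_pdivrMr//.
  have thp : 0 < s - (h + u) by lra.
  rewrite -(ler_pM2r thp).
  have := ler_wpM2r stp c1.
  have := ler_wpM2r (ltW hpos) c2; lra.
Unshelve. all: by end_near. Qed.

(** An open interval has positive measure, so it cannot lie in the exceptional null set. *)
Lemma ae_exists_itv (R : realType) (P : R -> Prop) (a b : R) :
  {ae @lebesgue_measure R, forall t, P t} -> a < b ->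
  exists t, [/\ a < t, t < b & P t].
Proof.
move=> [N [mN N0 PN]] ab; apply: contrapT => /forallNP nex.
have abN : `]a, b[%classic `<=` N.
  move=> t /=; rewrite in_itv /= => /andP[ta tb]; apply: PN => /= Pt.
  by apply: (nex t).
have ab0 := @subset_measure0 _ _ _ (@lebesgue_measure R) _ _
  (measurable_itv `]a, b[) mN abN N0.
have := etrans (esym (lebesgue_measure_itv `]a, b[)) ab0.
rewrite /= lte_fin ab -EFinD => -[] /eqP.
by rewrite subr_eq0 gt_eqF.
Qed.

(** The translated measure agrees with Lebesgue measure on half-open intervals, hence everywhere, so
    the translated exceptional set is null. *)
Lemma ae_shift (R : realType) (P : R -> Prop) (a : R) :
  {ae @lebesgue_measure R, forall t, P t} ->
  {ae @lebesgue_measure R, forall t, P (t + a)}.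
Proof.
move=> [N [mN N0 PN]].
pose s : R -> measurableTypeR R := fun t => t + a.
have ms : measurable_fun setT s by apply: measurable_realfun.measurable_funD.
exists (s @^-1` N); split.
- by rewrite -[X in measurable X]setTI; exact: ms.
- rewrite -N0; apply/esym.
  apply: (@lebesgue_measure_unique R (pushforward (@lebesgue_measure R) s)) => //=.
  move=> _ [[x y] _ <-].
  rewrite /pushforward (_ : s @^-1` _ = `]x - a, y - a]%classic); last first.
    by apply/seteqP; split=> t /=; rewrite !in_itv/= /s ltrBlDr lerBrDr.
  rewrite !lebesgue_measure_itv/= !lte_fin ltrD2r; case: ifP => // _.
  by rewrite -!EFinB; congr (_%:E); ring.
- by move=> t; apply: PN.
Qed.

Lemma ess_inf_mrestr_ae (R : realType) (D : set R) (mD : measurable D) (g : R -> R) :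
  (0 < ess_infr (mrestr (@lebesgue_measure R) mD) g)%E ->
  exists2 c : R, 0 < c & {ae @lebesgue_measure R, forall t, D t -> c <= g t}.
Proof.
move=> e0.
(* The essential infimum may be infinite, and then [c = 1] will do. *)
have [c c0 ce] : exists2 c : R, 0 < c &
    (c%:E <= ess_infr (mrestr (@lebesgue_measure R) mD) g)%E.
  move: e0; case: ess_inf => [r||] //; rewrite ?lte_fin => r0.
    by exists r.
  by exists 1; rewrite ?leey.
exists c => //; move/ess_infP : ce => [N [mN N0 gN]].
exists (N `&` D); split => //; first exact: measurableI.
move=> t /= /not_implyP [Dt gt]; split => //; apply: gN => /=.
by rewrite lee_fin.
Qed.

#[local] Instance lebesgue_ae_filter (R : realType) :
  Filter (almost_everywhere (@lebesgue_measure R)).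
Proof. exact: ae_filter_ringOfSetsType. Qed.

Lemma convex1_nondecreasing (R : realType) (f : R -> R) (s t : R) : convex1 f ->
  {ae @lebesgue_measure R, forall t, derivable f t 1 /\ 0 <= derive1 f t} ->
  s <= t -> f s <= f t.
Proof.
move=> fc fae; rewrite le_eqVlt => /predU1P[->//|st].
have [|u [_ us [fu fu0]]] := ae_exists_itv (a := s - 1) (b := s) fae; first by lra.
rewrite -subr_ge0; apply: le_trans (convex1_derive_le_slope fc fu us st).
by rewrite mulr_ge0 // subr_ge0 ltW.
Qed.

(** Slopes increase, so a derivative bound at one point beyond both [a] and [t] bounds every chord
    ending at [t]. *)
Lemma convex1_slope_le_right (R : realType) (f : R -> R) (l a s t : R) : convex1 f ->
  {ae @lebesgue_measure R, forall t, a <= t -> derivable f t 1 /\ derive1 f t <= l} ->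
  s <= t -> f t - f s <= l * (t - s).
Proof.
move=> fc fae; rewrite le_eqVlt => /predU1P[->|st]; first by rewrite !subrr mulr0.
have [|u [um _ Pu]] := ae_exists_itv (a := Num.max a t) (b := Num.max a t + 1) fae.
  by rewrite ltrDl.
move: um; rewrite gt_max => /andP[au tu].
have [fu ful] := Pu (ltW au).
apply: le_trans (convex1_slope_le_derive fc fu st tu) _.
by rewrite ler_wpM2r // subr_ge0 ltW.
Qed.

(** Points to the right of [t] may lie beyond [b], so the chord is cut at [t - d], with a good point
    between [t - d] and [t]; the remaining piece costs at most [d]. *)
Lemma convex1_slope_le_left (R : realType) (f : R -> R) (l b s t : R) : convex1 f ->
  (forall s t, s <= t -> f t - f s <= t - s) ->
  {ae @lebesgue_measure R, forall t, t <= b -> derivable f t 1 /\ derive1 f t <= l} ->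
  s <= t -> t <= b -> f t - f s <= l * (t - s).
Proof.
move=> fc flip fae; rewrite le_eqVlt => /predU1P[->|st] tb; first by rewrite !subrr mulr0.
apply/ler_addgt0Pr => e e0.
have st0 : 0 < t - s by rewrite subr_gt0.
(* The total error is at most [d * (1 - l)], hence at most [e]; the first bound keeps
   [s < t - d]. *)
pose d := Num.min ((t - s) / 2) (e / (1 + `|l|)).
have l1 : 0 < 1 + `|l| by have := normr_ge0 l; lra.
have d0 : 0 < d by rewrite lt_min !divr_gt0.
have ds : d < t - s.
  by rewrite gt_min; apply/orP; left; lra.
have de : d * (1 + `|l|) <= e.
  by rewrite -ler_pdivlMr// ge_min lexx orbT.
have [|u [tu ut Pu]] := ae_exists_itv (a := t - d) (b := t) fae; first by lra.
have [fu ful] := Pu (le_trans (ltW ut) tb).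
have std : s < t - d by lra.
have H1 := convex1_slope_le_derive fc fu std tu.
have H2 : f t - f (t - d) <= d.
  have td : t - d <= t by lra.
  have := flip _ _ td; lra.
have H3 : derive1 f u * (t - d - s) <= l * (t - d - s).
  by rewrite ler_wpM2r // subr_ge0 ltW.
have := ler_norm l; have := ler_norm (- l); rewrite normrN => ? ?.
have : 0 <= d * (`|l| + l) by rewrite mulr_ge0 ?(ltW d0) //; lra.
nra.
Qed.

(** The slope limit below 1 bounds the slopes of all chords; in this form the information survives
    the shift to [htilde1] and [htilde2]. *)
Definition unit_slope (R : realType) (k : R -> R) : Prop :=
  convex1 k /\ forall s t, s <= t -> 0 <= k t - k s <= t - s.

Lemma convex_slope_unit_slope (R : realType) (h : R -> R) (alpha : R) :
  convex_slope h alpha -> unit_slope h.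
Proof.
move=> [/convex_function_convex1 hc hae hlim /andP[_ alpha1]]; split=> // s t st.
rewrite subr_ge0 convex1_nondecreasing //=; rewrite -[leRHS]mul1r.
(* With tolerance [1 - alpha] the derivative is eventually below 1; [M + 1] below turns the strict
   [M < t] into a closed half-line. *)
have [|M hM] := hlim (1 - alpha); first by rewrite subr_gt0.
apply: (@convex1_slope_le_right _ _ _ (M + 1)) => //.
move: hM hae; apply: filterS2 => u uM [hu _] Mu; split=> //.
have /uM : M < u by lra.
have := ler_norm (derive1 h u - alpha); lra.
Qed.

Lemma unit_slope_shift (R : realType) (h : R -> R) (a b : R) :
  unit_slope h -> unit_slope (fun t => - b + h (t + a)).
Proof.
move=> [hc hs]; split=> [w x y w01|s t st].
  have := hc w (x + a) (y + a) w01.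
  have -> : w * (x + a) + (1 - w) * (y + a) = w * x + (1 - w) * y + a by ring.
  lra.
have sta : s + a <= t + a by lra.
have := hs _ _ sta; lra.
Qed.

Lemma derivable_shift (R : realType) (h : R -> R) (a b t : R) :
  derivable h (t + a) 1 -> derivable (fun t => - b + h (t + a)) t 1.
Proof.
rewrite /derivable.
set F := (X in cvg (X @ _)); set G := (X in _ -> cvg (X @ _)).
suff -> : F = G by [].
by apply/funext => e; rewrite /F /G /= addrA; congr (_ *: _); ring.
Qed.

Lemma convex_slope_ae_derivable (R : realType) (h : R -> R) (alpha a b : R) :
  convex_slope h alpha ->
  {ae @lebesgue_measure R, forall t, derivable (fun t => - b + h (t + a)) t 1}.
Proof.
move=> [_ hae _ _]; move: (ae_shift a hae); apply: filterS => t [ht _].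
exact: derivable_shift.
Qed.

(** * Convex functions with prescribed values along a curve *)

(** Meant for a linear form read along a half-curve with parameter [t >= 0]; the essential infimum
    conditions give the lower rate on that half only. *)
Definition rises (R : realType) (F : R -> R) (c L : R) : Prop :=
  [/\ F 0 = 0, forall s t, 0 <= s -> s <= t -> c * (t - s) <= F t - F s
    & forall s t, `|F t - F s| <= L * `|t - s|].

(** The lower rate gives [y <= F (y / c)], and the intermediate value theorem applies on
    [[0, y / c]]. *)
Lemma rises_surj (R : realType) (F : R -> R) (c L y : R) :
  rises F c L -> 0 < c -> 0 <= y -> exists2 t, 0 <= t & F t = y.
Proof.
move=> [F0 Fc FL] c0 y0.
have Fcont : continuous F.
  by apply: (@lipschitz_bound_continuous R R R F L) => s t; exact: FL.
have yc : 0 <= y / c by rewrite divr_ge0 // ltW.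
have Fy : y <= F (y / c).
  have := Fc _ _ (lexx 0) yc; rewrite F0 !subr0 mulrC divfK // gt_eqF//.
have [||t tI Ft] := @IVT R F 0 (y / c) y yc.
- exact: continuous_subspaceT.
- by rewrite F0 ge_min y0 le_max Fy orbT.
- by exists t => //; move: tI; rewrite in_itv/= => /andP[].
Qed.

Lemma rises_ge0 (R : realType) (F : R -> R) (c L t : R) :
  rises F c L -> 0 < c -> 0 <= t -> 0 <= F t.
Proof.
move=> [F0 Fc _] c0 t0; have := Fc _ _ (lexx 0) t0; rewrite F0 !subr0.
by apply: le_trans; rewrite mulr_ge0 // ltW.
Qed.

Lemma rises_gt0 (R : realType) (F : R -> R) (c L t : R) :
  rises F c L -> 0 < c -> 0 < t -> 0 < F t.
Proof.
move=> [F0 Fc _] c0 t0; have := Fc _ _ (lexx 0) (ltW t0); rewrite F0 !subr0.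
by apply: lt_le_trans; rewrite mulr_gt0.
Qed.

(** Profile of one piece of the potential. Vanishing on the negative axis makes the piece drop out
    of the maximum where its linear form is negative. *)
Definition gauge (R : realType) (th : R -> R) (c L : R) : Prop :=
  [/\ convex1 th, forall s, s <= 0 -> th s = 0,
      forall s t, 0 <= s -> s <= t -> c * (t - s) <= th t - th s
    & forall s t, s <= t -> 0 <= th t - th s <= L * (t - s)].

(* [th] is [G] composed with the inverse of [M]: the inverse of an increasing
   concave function is convex. *)
Lemma gauge_exists (R : realType) (G M : R -> R) (cG LG cM LM : R) :
  rises G cG LG -> rises M cM LM -> 0 < cG -> 0 < LG -> 0 < cM -> 0 < LM ->
  convex1 G -> convex1 (fun t => - M t) ->
  exists2 th, gauge th (cG / LM) (LG / cM) & forall t, 0 <= t -> th (M t) = G t.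
Proof.
move=> Gr Mr cG0 LG0 cM0 LM0 Gc Mc.
have [G0 Gc' GL] := Gr; have [M0 Mc' ML] := Mr.
(* [m] is the inverse of [M] on the half-line, extended by zero. *)
have /choice[m mP] : forall s, exists t, 0 <= t /\ M t = Num.max s 0.
  move=> s; have s0 : 0 <= Num.max s 0 by rewrite le_max lexx orbT.
  by have [t t0 Mt] := rises_surj Mr cM0 s0; exists t.
have m0 s : 0 <= m s by case: (mP s).
have Mm s : M (m s) = Num.max s 0 by case: (mP s).
have M_le s t : 0 <= s -> 0 <= t -> M s <= M t -> s <= t.
  move=> s0 t0 Mst; rewrite leNgt; apply/negP => ts.
  have := Mc' _ _ t0 (ltW ts).
  have : 0 < cM * (s - t) by rewrite mulr_gt0// subr_gt0.
  lra.
have G_le s t : 0 <= s -> s <= t -> G s <= G t.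
  move=> s0 st; have := Gc' _ _ s0 st.
  have : 0 <= cG * (t - s) by rewrite mulr_ge0 ?(ltW cG0)// subr_ge0.
  lra.
have m_le s t : s <= t -> m s <= m t.
  by move=> st; apply: M_le => //; rewrite !Mm ge_max !le_max st lexx !orbT.
exists (G \o m); last first.
  move=> t t0 /=; congr G; apply/le_anti/andP.
  have Mt0 : 0 <= M t := rises_ge0 Mr cM0 t0.
  by split; apply: M_le => //; rewrite Mm (max_idPl Mt0).
split.
- move=> w x y /andP[w0 w1] /=.
  set p := m x; set q := m y.
  have p0 : 0 <= p := m0 _. have q0 : 0 <= q := m0 _.
  have w1' : 0 <= 1 - w by lra.
  have pq0 : 0 <= w * p + (1 - w) * q by rewrite addr_ge0 ?mulr_ge0.
  (* Concavity of [M] puts [m] of the combination below the combination of [p] and [q]; then [G] is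
     increasing and convex. *)
  apply: (@le_trans _ _ (G (w * p + (1 - w) * q))); last by apply: Gc; rewrite w0.
  apply: G_le => //; apply: M_le => //.
  have := Mc w p q; rewrite w0 w1 => /(_ isT).
  have xp : x <= M p /\ 0 <= M p by rewrite Mm !le_max !lexx orbT.
  have yq : y <= M q /\ 0 <= M q by rewrite Mm !le_max !lexx orbT.
  case: xp yq => xp p0' [yq q0'].
  have Hp := ler_wpM2l w0 xp; have Hq := ler_wpM2l w1' yq.
  have Hp' := mulr_ge0 w0 p0'; have Hq' := mulr_ge0 w1' q0'.
  by move=> H; rewrite Mm ge_max; apply/andP; split; lra.
- move=> s s0 /=; rewrite (_ : m s = 0) //; apply/le_anti/andP; split => //.
  by apply: M_le => //; rewrite Mm M0 (max_idPr s0).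
- move=> s t s0 st /=.
  apply: le_trans (Gc' _ _ (m0 s) (m_le _ _ st)).
  rewrite -mulrA ler_pM2l// mulrC ler_pdivrMr// mulrC.
  have := ML (m s) (m t); rewrite !Mm (max_idPl s0) (max_idPl (le_trans s0 st)).
  by rewrite !ger0_norm // subr_ge0 // m_le.
- move=> s t st /=; rewrite subr_ge0 G_le ?m_le //=.
  have := GL (m s) (m t); rewrite (ger0_norm (x := m t - _)) ?subr_ge0 ?m_le// => H.
  apply: le_trans (le_trans (ler_norm _) H) _.
  rewrite -mulrA ler_pM2l// mulrC ler_pdivlMr// mulrC.
  apply: le_trans (Mc' _ _ (m0 s) (m_le _ _ st)) _.
  rewrite !Mm; case: (leP s 0) => s0; case: (leP t 0) => t0; lra.
Qed.

(** Values of a finished piece along the next half-curve rise again, so they can be the [G] of a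
    second use of [gauge_exists]. *)
Lemma gauge_rises (R : realType) (th N : R -> R) (c L c' L' : R) :
  gauge th c L -> 0 <= c -> 0 <= L -> rises N c' L' -> 0 < c' ->
  rises (th \o N) (c * c') (L * L').
Proof.
move=> [_ th0 thc thL] c0 L0 Nr c'0; have [N0 Nc NL] := Nr; split.
- by rewrite /= N0 th0.
- move=> s t s0 st /=.
  have Nst : N s <= N t.
    rewrite -subr_ge0; apply: le_trans (Nc _ _ s0 st).
    by rewrite mulr_ge0 ?subr_ge0// ltW.
  apply: le_trans (thc _ _ (rises_ge0 Nr c'0 s0) Nst).
  by rewrite -mulrA ler_wpM2l// Nc.
- move=> s t /=; rewrite -mulrA.
  apply: le_trans (ler_wpM2l L0 (NL s t)).
  have [st|st] := leP (N s) (N t).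
    have /andP[H1 H2] := thL _ _ st; rewrite !ger0_norm // subr_ge0//.
  have /andP[H1 H2] := thL _ _ (ltW st).
  by rewrite (distrC (th (N t))) (distrC (N t)) !ger0_norm // subr_ge0 ltW.
Qed.

Lemma convex1_comp (R : realType) (th N : R -> R) (c L : R) :
  gauge th c L -> convex1 N -> convex1 (th \o N).
Proof.
move=> [thc _ _ thL] Nc w x y w01 /=; apply: le_trans (thc _ _ _ w01).
by have /andP[H _] := thL _ _ (Nc w x y w01); rewrite -subr_ge0.
Qed.

(** * The piecewise potential *)

Section potential.
Variables (R : realType) (a0 b0 a1 b1 a2 b2 g : R) (th1 th2 th3 th4 : R -> R).

(** The signs of the forms are written out, so that all coefficients are positive in use. Grouping
    [th1] with [th3] and [th2] with [th4] makes the exchange of coordinates in [potentialC] a mere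
    commutation. *)
Definition potential (x y : R) : R :=
  Num.max (a0 * x + b0 * y)
    (Num.max (Num.max (th1 (b1 * y - a1 * x)) (th3 (- x - g * y)))
             (Num.max (th2 (a2 * x - b2 * y)) (th4 (- y - g * x)))).

Lemma potential_le (x y l : R) : potential x y <= l =
  [&& a0 * x + b0 * y <= l, th1 (b1 * y - a1 * x) <= l, th3 (- x - g * y) <= l,
      th2 (a2 * x - b2 * y) <= l & th4 (- y - g * x) <= l].
Proof. by rewrite /potential !ge_max !andbA. Qed.

Lemma le_potential (x y : R) :
  [/\ a0 * x + b0 * y <= potential x y, th1 (b1 * y - a1 * x) <= potential x y,
      th3 (- x - g * y) <= potential x y, th2 (a2 * x - b2 * y) <= potential x y
    & th4 (- y - g * x) <= potential x y].
Proof. by have := lexx (potential x y); rewrite {1}potential_le => /and5P[]. Qed.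

End potential.

Lemma potentialC (R : realType) (a0 b0 a1 b1 a2 b2 g : R) (th1 th2 th3 th4 : R -> R)
    (x y : R) :
  potential a0 b0 a1 b1 a2 b2 g th1 th2 th3 th4 x y =
  potential b0 a0 b2 a2 b1 a1 g th2 th1 th4 th3 y x.
Proof.
by rewrite /potential; congr Num.max; [exact: addrC | exact: maxC].
Qed.

Lemma gauge_npos (R : realType) (th : R -> R) (c L s : R) :
  gauge th c L -> s <= 0 -> th s = 0.
Proof. by move=> [_ th0 _ _] /th0. Qed.

Lemma gauge_le (R : realType) (th : R -> R) (c L s t : R) :
  gauge th c L -> s <= t -> th s <= th t.
Proof. by move=> [_ _ _ thL] /thL /andP[]; rewrite subr_ge0. Qed.

Lemma gauge_ge0 (R : realType) (th : R -> R) (c L s : R) : gauge th c L -> 0 <= th s.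
Proof.
move=> thg; have [_ th0 _ _] := thg.
rewrite -(th0 (Num.min s 0)); last by rewrite ge_min lexx orbT.
by apply: (gauge_le thg); rewrite ge_min lexx.
Qed.

Lemma gauge_weaken (R : realType) (th : R -> R) (c L c' L' : R) :
  gauge th c L -> c' <= c -> L <= L' -> gauge th c' L'.
Proof.
move=> [thc th0 thl thL] cc LL; split => // s t.
  move=> s0 st; apply: le_trans (thl _ _ s0 st).
  by rewrite ler_wpM2r // subr_ge0.
move=> st; have /andP[-> H] /= := thL _ _ st; apply: le_trans H _.
by rewrite ler_wpM2r // subr_ge0.
Qed.

Lemma unit_slope_nneg (R : realType) (k : R -> R) (t : R) :
  unit_slope k -> k 0 = 0 -> 0 <= t -> 0 <= k t <= t.
Proof. by move=> [_ ks] k0 /ks; rewrite k0 !subr0. Qed.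

Lemma unit_slope_npos (R : realType) (k : R -> R) (t : R) :
  unit_slope k -> k 0 = 0 -> t <= 0 -> t <= k t <= 0.
Proof. by move=> [_ ks] k0 /ks; rewrite k0 !sub0r; lra. Qed.

(* Along the curve [x = k1 y] the two pieces of the potential that are relevant
   on its two sides coincide and dominate the others. *)
Lemma potential_projection (R : realType) (k1 k2 : R -> R)
    (a0 b0 a1 b1 a2 b2 g c L kap : R) (th1 th2 th3 th4 : R -> R) :
  unit_slope k1 -> k1 0 = 0 -> unit_slope k2 -> k2 0 = 0 ->
  [/\ 0 < a0, 0 < b0, 0 < a1 & 0 < a2] -> 0 < b2 -> 0 < g -> 0 < c ->
  [/\ gauge th1 c L, gauge th2 c L, gauge th3 c L & gauge th4 c L] ->
  (forall t, 0 <= t -> 0 <= b1 * t - a1 * k1 t /\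
     th1 (b1 * t - a1 * k1 t) = a0 * k1 t + b0 * t) ->
  (forall t, 0 <= t -> th2 (a2 * t - b2 * k2 t) = a0 * t + b0 * k2 t) ->
  (forall t, 0 <= t -> 0 <= a2 * k1 (- t) + b2 * t /\
     th4 (t - g * k1 (- t)) = th2 (a2 * k1 (- t) + b2 * t)) ->
  (forall t, 0 <= t ->
     th1 (- (b1 * t) - a1 * k1 (- t)) <= th2 (a2 * k1 (- t) + b2 * t) /\
     th3 (- k1 (- t) + g * t) <= th2 (a2 * k1 (- t) + b2 * t)) ->
  [/\ kap <= a0, kap <= c * a1, kap <= c * a2 & kap <= c * g] ->
  let phi := potential a0 b0 a1 b1 a2 b2 g th1 th2 th3 th4 in
  forall x y, phi (k1 y) y + kap * `|x - k1 y| <= phi x y /\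
    kap * `|k1 y| <= phi (k1 y) y.
Proof.
move=> k1u k10 k2u k20 [a00 b00 a10 a20] b20 g0 c0 [g1 g2 g3 g4] PQ PR RS SL.
move=> [ka0 ka1 ka2 kg] phi x y.
have th_nneg := (gauge_ge0 _ g1, gauge_ge0 _ g2, gauge_ge0 _ g3, gauge_ge0 _ g4).
have [ge0 ge1 ge3 ge2 ge4] := le_potential a0 b0 a1 b1 a2 b2 g th1 th2 th3 th4 x y.
rewrite -/phi in ge0 ge1 ge2 ge3 ge4.
have [y0|y0] := leP 0 y.
(* Upper half: the first piece and [th1] meet at [(q, y)]. As [k2 q <= q <= y], [th2] is at most its
   value at [(q, k2 q)]; the forms of [th3] and [th4] are nonpositive. *)
- have /andP[q0 qy] := unit_slope_nneg k1u k10 y0.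
  set q := k1 y in q0 qy *.
  have [M1y th1q] := PQ _ y0; rewrite -/q in M1y th1q.
  have phiq : phi q y = a0 * q + b0 * y.
    apply/le_anti/andP; split; last first.
      by case: (le_potential a0 b0 a1 b1 a2 b2 g th1 th2 th3 th4 q y).
    have l0 : 0 <= a0 * q + b0 * y by rewrite addr_ge0 // mulr_ge0 // ltW.
    rewrite potential_le lexx th1q lexx /=; apply/and3P; split.
    + by rewrite (gauge_npos g3) //; have := mulr_ge0 (ltW g0) y0; lra.
    + have /andP[k2q0 k2q] := unit_slope_nneg k2u k20 q0.
      apply: (@le_trans _ _ (th2 (a2 * q - b2 * k2 q))).
        apply: (gauge_le g2); rewrite lerD2l lerN2 ler_pM2l //; lra.
      by rewrite PR // lerD2l ler_pM2l //; lra.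
    + by rewrite (gauge_npos g4) //; have := mulr_ge0 (ltW g0) q0; lra.
  rewrite phiq; split; last first.
    rewrite ger0_norm //; have := ler_wpM2r q0 ka0.
    have := mulr_ge0 (ltW b00) y0; lra.
  (* To the right the first piece grows at rate [a0], to the left [th1] grows at rate at least
     [c * a1]. *)
  have [xq|xq] := leP q x.
    rewrite ger0_norm ?subr_ge0 //; have xq' : 0 <= x - q by lra.
    have := ler_wpM2r xq' ka0; lra.
  rewrite ltr0_norm ?subr_lt0 //; have xq' : 0 <= q - x by lra.
  apply: le_trans ge1.
  have [_ _ thl _] := g1.
  have := thl _ (b1 * y - a1 * x) M1y; rewrite th1q lerD2l lerN2.
  rewrite ler_wpM2l ?(ltW xq) ?(ltW a10) // => /(_ isT).
  have := ler_wpM2r xq' ka1; lra.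
(* Lower half: [th2] and [th4] meet at [(q, y)], and [SL] puts [th1] and [th3] below them. *)
- have t0 : 0 <= - y by lra.
  have /andP[qy q0] := unit_slope_npos k1u k10 (ltW y0).
  have [N2y th4q] := RS _ t0; have [sl1 sl3] := SL _ t0.
  move: N2y th4q sl1 sl3; rewrite opprK; set q := k1 y in qy q0 *.
  have -> : a2 * q + b2 * - y = a2 * q - b2 * y by ring.
  have -> : - (b1 * - y) - a1 * q = b1 * y - a1 * q by ring.
  have -> : - q + g * - y = - q - g * y by ring.
  move=> N2y th4q sl1 sl3.
  have phiq : phi q y = th2 (a2 * q - b2 * y).
    apply/le_anti/andP; split; last first.
      by case: (le_potential a0 b0 a1 b1 a2 b2 g th1 th2 th3 th4 q y).
    rewrite potential_le lexx th4q lexx sl1 sl3 /= andbT.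
    apply: (@le_trans _ _ 0) => //; last by rewrite th_nneg.
    have q0' : 0 <= - q by lra.
    have := mulr_ge0 (ltW a00) q0'; have := mulr_ge0 (ltW b00) t0; lra.
  have gq : 0 <= - (g * q) by rewrite -mulrN mulr_ge0 ?(ltW g0) //; lra.
  rewrite phiq; split; last first.
    (* Here [q <= 0], and the form of [th4] is at least [- g * q], which bounds the modulus of
       [q]. *)
    rewrite ler0_norm // -th4q.
    have [_ th40 thl _] := g4.
    have q4 : 0 <= - y - g * q by lra.
    have := thl 0 _ (lexx _) q4.
    rewrite (th40 0) // !subr0.
    have q0' : 0 <= - q by lra.
    have := ler_wpM2r q0' kg; have := mulr_ge0 (ltW c0) t0; lra.
  have [xq|xq] := leP q x.
    rewrite ger0_norm ?subr_ge0 //; have xq' : 0 <= x - q by lra.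
    apply: le_trans ge2.
    have [_ _ thl _] := g2.
    have := thl _ (a2 * x - b2 * y) N2y; rewrite lerD2r.
    rewrite ler_wpM2l ?(ltW a20) // => /(_ isT).
    have := ler_wpM2r xq' ka2; lra.
  rewrite ltr0_norm ?subr_lt0 //; have xq' : 0 <= q - x by lra.
  apply: le_trans ge4.
  have [_ _ thl _] := g4.
  have := thl (- y - g * q) (- y - g * x); rewrite th4q lerD2l lerN2.
  rewrite ler_wpM2l ?(ltW xq) ?(ltW g0) // => H.
  have {}H : c * (- y - g * x - (- y - g * q)) <= th4 (- y - g * x) - th2 (a2 * q - b2 * y).
    by apply: H => //; lra.
  have := ler_wpM2r xq' kg; lra.
Qed.

Lemma unit_slope_lip (R : realType) (k : R -> R) (s t : R) :
  unit_slope k -> `|k t - k s| <= `|t - s|.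
Proof.
move=> [_ ks]; wlog st : s t / s <= t.
  move=> H; have [/H//|/ltW/H] := leP s t.
  by rewrite (distrC (k s)) (distrC s).
by have /andP[k0 kts] := ks _ _ st; rewrite !ger0_norm // subr_ge0.
Qed.

Lemma lip_combination (R : realType) (A B X Y Z : R) : 0 <= A -> 0 <= B ->
  `|X| <= Z -> `|Y| <= Z -> `|A * X + B * Y| <= (A + B) * Z.
Proof.
move=> A0 B0 XZ YZ; apply: le_trans (ler_normD _ _) _.
by rewrite !normrM (ger0_norm A0) (ger0_norm B0) mulrDl lerD // ler_wpM2l.
Qed.

(** The essential infimum bounds the derivative of [k] by [(B - c) / A] on the half-line; convexity
    carries this bound to chords. *)
Lemma ess_inf_nneg_rises (R : realType) (k : R -> R) (A B : R) :
  unit_slope k -> k 0 = 0 -> 0 < A -> 0 < B ->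
  {ae @lebesgue_measure R, forall t, derivable k t 1} ->
  (0 < ess_inf_nneg (fun t => (B - A * derive1 k t)%R))%E ->
  exists2 c, 0 < c & rises (fun t => B * t - A * k t) c (A + B).
Proof.
move=> ku k0 A0 B0 kder /ess_inf_mrestr_ae[c c0 cae]; exists c => //.
split; first by rewrite k0; ring.
- move=> s t s0 st.
  have : k t - k s <= (B - c) / A * (t - s).
    apply: (@convex1_slope_le_right _ k _ 0) => //; first by case: ku.
    move: kder cae; apply: filterS2 => u ud cu u0; split=> //.
    rewrite ler_pdivlMr // mulrC; have := cu _; rewrite /= in_itv /= u0 => /(_ isT); lra.
  rewrite mulrAC ler_pdivlMr //; lra.
- move=> s t.
  have -> : B * t - A * k t - (B * s - A * k s) =
    A * - (k t - k s) + B * (t - s) by ring.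
  by apply: lip_combination; rewrite ?(ltW A0) ?(ltW B0) // normrN unit_slope_lip.
Qed.

(** The lower half-curve is parametrized by minus the coordinate, so the chords end at [- s <= 0],
    the endpoint zero included. *)
Lemma ess_inf_npos_rises (R : realType) (k : R -> R) (A B : R) :
  unit_slope k -> k 0 = 0 -> 0 < A -> 0 < B ->
  {ae @lebesgue_measure R, forall t, derivable k t 1} ->
  (0 < ess_inf_npos (fun t => (A - B * derive1 k t)%R))%E ->
  exists2 c, 0 < c & rises (fun t => A * t + B * k (- t)) c (A + B).
Proof.
move=> ku k0 A0 B0 kder /ess_inf_mrestr_ae[c c0 cae]; exists c => //.
split; first by rewrite oppr0 k0; ring.
- move=> s t s0 st.
  have : k (- s) - k (- t) <= (A - c) / B * (- s - - t).
    apply: (@convex1_slope_le_left _ k _ 0) => //; [by case: ku| |  |lra|lra].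
      by move=> x y xy; case: ku => _ /(_ _ _ xy)/andP[].
    move: kder cae; apply: filterS2 => u ud cu u0; split=> //.
    rewrite ler_pdivlMr // mulrC; have := cu _; rewrite /= in_itv /= u0 => /(_ isT); lra.
  rewrite mulrAC ler_pdivlMr //; lra.
- move=> s t.
  have -> : A * t + B * k (- t) - (A * s + B * k (- s)) =
    A * (t - s) + B * (k (- t) - k (- s)) by ring.
  apply: lip_combination; rewrite ?(ltW A0) ?(ltW B0) //.
  apply: le_trans (unit_slope_lip _ _ ku) _.
  by rewrite (_ : - t - - s = - (t - s)) ?normrN //; ring.
Qed.

Lemma dot_vec2 (R : realType) (v : 'rV[R]_2) (x y : R) :
  dot v (vec2 x y) = v 0 0 * x + v 0 1 * y.
Proof. by rewrite dotE !mxE. Qed.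

(* If the segment from [xQS] to [xRS] went up and to the left, the two points
   would lie on the wrong sides of the diagonal. *)
Lemma slope_condition_coord (R : realType) (k1 k2 : R -> R) (v0 v1 v2 : 'rV[R]_2)
    (g lam p q s t : R) :
  unit_slope k1 -> k1 0 = 0 -> unit_slope k2 -> k2 0 = 0 -> 0 < g ->
  (forall xPQ xPR xQS xRS : 'rV[R]_2,
      is_xPQ k1 v0 lam xPQ -> is_xPR k2 v0 lam xPR ->
      is_xQS k2 v1 (dot v1 xPQ) xQS -> is_xRS k1 v2 (dot v2 xPR) xRS ->
      - 1 / g <= slope xQS xRS <= - g) ->
  0 <= s -> 0 <= t ->
  dot v0 (vec2 (k1 p) p) = lam -> dot v0 (vec2 q (k2 q)) = lam ->
  dot v1 (vec2 (- s) (k2 (- s))) = dot v1 (vec2 (k1 p) p) ->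
  dot v2 (vec2 (k1 (- t)) (- t)) = dot v2 (vec2 q (k2 q)) ->
  [/\ 0 < k1 (- t) + s, g * (k2 (- s) + t) <= k1 (- t) + s
    & g * (k1 (- t) + s) <= k2 (- s) + t].
Proof.
move=> k1u k10 k2u k20 g0 slopeH s0 t0 PQ PR QS RS.
have s0' : - s <= 0 by lra. have t0' : - t <= 0 by lra.
have /andP[k1t1 k1t2] := unit_slope_npos k1u k10 t0'.
have /andP[k2s1 k2s2] := unit_slope_npos k2u k20 s0'.
have := slopeH (vec2 (k1 p) p) (vec2 q (k2 q)) (vec2 (- s) (k2 (- s)))
  (vec2 (k1 (- t)) (- t)).
rewrite /is_xPQ /is_xPR /is_xQS /is_xRS /on_curve1 /on_curve2 /nonpos_quadrant /slope.
rewrite !mxE /= => /(_ (conj PQ erefl) (conj PR erefl)) H.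
have {}H := H (And3 (conj s0' k2s2) QS erefl) (And3 (conj k1t2 t0') RS erefl).
move: H; rewrite opprK.
have -> : - t - k2 (- s) = - (k2 (- s) + t) by ring.
set d := k1 (- t) + s; set e := k2 (- s) + t.
rewrite !mulNr mul1r lerN2 lerN2 => /andP[ed1 ed2].
have [d0|d0|d0] := ltgtP d 0.
- move: ed2; rewrite ler_ndivlMr // => ed2.
  have : g * d < 0 by rewrite pmulr_rlt0.
  rewrite /d /e in d0 ed2 *; lra.
- split=> //; first by move: ed1; rewrite ler_pdivrMr // ler_pdivlMl.
  by move: ed2; rewrite ler_pdivlMr.
(* A zero denominator gives slope 0, which is above [- g]. *)
- by move: ed2; rewrite d0 invr0 mulr0; lra.
Qed.

Lemma gauge_lip (R : realType) (th : R -> R) (c L s t : R) :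
  gauge th c L -> 0 <= L -> th s <= th t + L * `|s - t|.
Proof.
move=> thg L0; have [st|ts] := leP s t.
  by apply: le_trans (gauge_le thg st) _; rewrite lerDl mulr_ge0.
have [_ _ _ thL] := thg; have := thL _ _ (ltW ts).
by rewrite gtr0_norm ?subr_gt0 // lerBlDl => /andP[].
Qed.

Lemma potential_lip (R : realType) (a0 b0 a1 b1 a2 b2 g c L : R)
    (th1 th2 th3 th4 : R -> R)
    (x y x' y' : R) :
  [/\ 0 <= a0, 0 <= b0, 0 <= a1 & 0 <= b1] -> [/\ 0 <= a2, 0 <= b2, 0 <= g & 0 <= L] ->
  [/\ gauge th1 c L, gauge th2 c L, gauge th3 c L & gauge th4 c L] ->
  potential a0 b0 a1 b1 a2 b2 g th1 th2 th3 th4 x y <=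
  potential a0 b0 a1 b1 a2 b2 g th1 th2 th3 th4 x' y' +
    (a0 + b0 + L * (a1 + b1 + a2 + b2 + 1 + g)) * (`|x - x'| + `|y - y'|).
Proof.
move=> [a00 b00 a10 b10] [a20 b20 g0 L0] [g1 g2 g3 g4].
set phi := potential a0 b0 a1 b1 a2 b2 g th1 th2 th3 th4.
have [le0 le1 le3 le2 le4] := le_potential a0 b0 a1 b1 a2 b2 g th1 th2 th3 th4 x' y'.
rewrite -/phi in le0 le1 le3 le2 le4.
set D := _ + `|_|.
have D0 : 0 <= D by rewrite addr_ge0.
have Dx : `|x - x'| <= D by rewrite lerDl.
have Dy : `|y - y'| <= D by rewrite lerDr.
set S := a1 + b1 + a2 + b2 + 1 + g.
have S0 : 0 <= S by rewrite !addr_ge0.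
have LSD : 0 <= L * S * D by rewrite !mulr_ge0.
have abD : 0 <= (a0 + b0) * D by rewrite mulr_ge0 // addr_ge0.
(* The three alternatives are the sign patterns of the four forms. *)
have lin A B X X' : 0 <= A -> 0 <= B -> A + B <= S ->
    X - X' = A * - (x - x') + B * (y - y') \/ X - X' = A * (x - x') + B * - (y - y') \/
    X - X' = A * - (x - x') + B * - (y - y') ->
    L * `|X - X'| <= L * S * D.
  move=> A0 B0 ABS XX; rewrite -mulrA ler_wpM2l //.
  apply: (@le_trans _ _ ((A + B) * D)); last by rewrite ler_wpM2r.
  by case: XX => [->|[->|->]]; apply: lip_combination; rewrite ?normrN.
rewrite potential_le mulrDl; apply/and5P; split.
- have : a0 * (x - x') + b0 * (y - y') <= (a0 + b0) * D.
    by apply: le_trans (ler_norm _) _; apply: lip_combination.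
  lra.
- apply: le_trans (gauge_lip _ (b1 * y' - a1 * x') g1 L0) _.
  have := lin a1 b1 (b1 * y - a1 * x) (b1 * y' - a1 * x') a10 b10.
  have -> : a1 + b1 <= S by rewrite /S; lra.
  move=> /(_ isT) H; have {}H := H (or_introl _); lra.
- apply: le_trans (gauge_lip _ (- x' - g * y') g3 L0) _.
  have := lin 1 g (- x - g * y) (- x' - g * y') ler01 g0.
  have -> : 1 + g <= S by rewrite /S; lra.
  move=> /(_ isT) H; have {}H := H (or_intror (or_intror _)); lra.
- apply: le_trans (gauge_lip _ (a2 * x' - b2 * y') g2 L0) _.
  have := lin a2 b2 (a2 * x - b2 * y) (a2 * x' - b2 * y') a20 b20.
  have -> : a2 + b2 <= S by rewrite /S; lra.
  move=> /(_ isT) H; have {}H := H (or_intror (or_introl _)); lra.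
- apply: le_trans (gauge_lip _ (- y' - g * x') g4 L0) _.
  have := lin g 1 (- y - g * x) (- y' - g * x') g0 ler01.
  have -> : g + 1 <= S by rewrite /S; lra.
  move=> /(_ isT) H; have {}H := H (or_intror (or_intror _)); lra.
Qed.

Lemma potential_midpoint (R : realType) (a0 b0 a1 b1 a2 b2 g : R)
    (th1 th2 th3 th4 : R -> R) (x y x' y' : R) :
  convex1 th1 -> convex1 th2 -> convex1 th3 -> convex1 th4 ->
  potential a0 b0 a1 b1 a2 b2 g th1 th2 th3 th4 ((x + x') / 2) ((y + y') / 2) <=
  (potential a0 b0 a1 b1 a2 b2 g th1 th2 th3 th4 x y +
   potential a0 b0 a1 b1 a2 b2 g th1 th2 th3 th4 x' y') / 2.
Proof.
move=> c1 c2 c3 c4.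
set phi := potential a0 b0 a1 b1 a2 b2 g th1 th2 th3 th4.
have [le0 le1 le3 le2 le4] := le_potential a0 b0 a1 b1 a2 b2 g th1 th2 th3 th4 x y.
have [le0' le1' le3' le2' le4'] := le_potential a0 b0 a1 b1 a2 b2 g th1 th2 th3 th4 x' y'.
rewrite -/phi in le0 le1 le3 le2 le4 le0' le1' le3' le2' le4'.
have w01 : 0 <= (2^-1 : R) <= 1 by lra.
have mid th u u' v (thc : convex1 th) : v = (u + u') / 2 ->
    th u <= phi x y -> th u' <= phi x' y' -> th v <= (phi x y + phi x' y') / 2.
  move=> -> H H'; have := thc _ u u' w01.
  have -> : 2^-1 * u + (1 - 2^-1) * u' = (u + u') / 2 by field.
  lra.
rewrite potential_le; apply/and5P; split; first by lra.
- by apply: mid le1 le1' => //; field.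
- by apply: mid le3 le3' => //; field.
- by apply: mid le2 le2' => //; field.
- by apply: mid le4 le4' => //; field.
Qed.

Lemma convex1_add_linear (R : realType) (k F : R -> R) (A B : R) :
  convex1 k -> 0 <= A -> (forall t, F t = A * k t + B * t) -> convex1 F.
Proof.
move=> kc A0 FE w x y w01; rewrite !FE.
have := ler_wpM2l A0 (kc w x y w01); lra.
Qed.

Lemma rises_unit_slope (R : realType) (k : R -> R) (A B : R) :
  unit_slope k -> k 0 = 0 -> 0 <= A -> 0 <= B ->
  rises (fun t => A * k t + B * t) B (A + B).
Proof.
move=> ku k0 A0 B0; split.
- by rewrite k0 !mulr0 addr0.
- move=> s t _ st; have [_ /(_ _ _ st) /andP[kst _]] := ku.
  have := mulr_ge0 A0 kst; lra.
- move=> s t.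
  have -> : A * k t + B * t - (A * k s + B * s) = A * (k t - k s) + B * (t - s) by ring.
  by apply: lip_combination => //; exact: unit_slope_lip.
Qed.

(** These are the forms [-(1, g)] and [-(g, 1)] along the lower halves of the two curves. *)
Lemma rises_reflect (R : realType) (k : R -> R) (g : R) :
  unit_slope k -> k 0 = 0 -> 0 <= g -> rises (fun t => t - g * k (- t)) 1 (g + 1).
Proof.
move=> ku k0 g0; split.
- by rewrite oppr0 k0 mulr0 subr0.
- move=> s t _ st; have ts : - t <= - s by rewrite lerN2.
  have [_ /(_ _ _ ts) /andP[kst _]] := ku.
  have := mulr_ge0 g0 kst; lra.
- move=> s t.
  have -> : t - g * k (- t) - (s - g * k (- s)) = g * - (k (- t) - k (- s)) + 1 * (t - s).
    by ring.
  apply: lip_combination => //; rewrite normrN.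
  apply: le_trans (unit_slope_lip _ _ ku) _.
  by rewrite (_ : - t - - s = - (t - s)) ?normrN //; ring.
Qed.

(** [th1] and [th2] are fitted to [v0] along the upper half-curves, then [th3] to [th1] and [th4] to
    [th2] along the lower ones. The slope condition enters last: on each lower half-curve the pair
    fitted along the other one is dominated. *)
Lemma potential_exists (R : realType) (k1 k2 : R -> R) (v0 v1 v2 : 'rV[R]_2) :
  unit_slope k1 -> k1 0 = 0 -> unit_slope k2 -> k2 0 = 0 ->
  {ae @lebesgue_measure R, forall t, derivable k1 t 1} ->
  {ae @lebesgue_measure R, forall t, derivable k2 t 1} ->
  admissible k1 k2 v0 v1 v2 -> slope_condition k1 k2 v0 v1 v2 ->
  exists (phi : R -> R -> R) (kap K : R), [/\ 0 < kap, 0 < K, phi 0 0 = 0 &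
    [/\ forall x y, 0 <= phi x y,
        forall x y x' y', phi x y <= phi x' y' + K * (`|x - x'| + `|y - y'|),
        forall x y x' y',
          phi ((x + x') / 2) ((y + y') / 2) <= (phi x y + phi x' y') / 2,
        forall x y, phi (k1 y) y + kap * `|x - k1 y| <= phi x y /\
                    kap * `|k1 y| <= phi (k1 y) y
      & forall x y, phi x (k2 x) + kap * `|y - k2 x| <= phi x y /\
                    kap * `|k2 x| <= phi x (k2 x)]].
Proof.
move=> k1u k10 k2u k20 k1d k2d.
have e10 : dot v1 (- e1) = - v1 0 0 by rewrite dotE !mxE /=; ring.
have e20 : dot v2 (- e2) = - v2 0 1 by rewrite dotE !mxE /=; ring.
have d1 (v : 'rV[R]_2) : dot v e1 = v 0 0 by rewrite dotE !mxE /=; ring.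
have d2 (v : 'rV[R]_2) : dot v e2 = v 0 1 by rewrite dotE !mxE /=; ring.
rewrite /admissible e10 e20 !d1 !d2.
set a0 := v0 0 0; set b0 := v0 0 1; set a1 := - v1 0 0; set b1 := v1 0 1.
set a2 := v2 0 0; set b2 := - v2 0 1.
move=> [[a00 b00 a10 b10] [a20 b20] [i1 i2] [i3 i4]].
(* [M1], [M2] concern [v1], [v2] along the upper half-curves, [N1], [N2] along the lower ones. *)
have [m1 m10 M1] : exists2 c, 0 < c & rises (fun t => b1 * t - a1 * k1 t) c (a1 + b1).
  apply: ess_inf_nneg_rises => //; congr (0 < ess_inf_nneg _)%E : i1.
  by apply/funext => t; rewrite dot_vec2 /a1 /b1; ring.
have [n1 n10 N1] : exists2 c, 0 < c & rises (fun t => a1 * t + b1 * k2 (- t)) c (a1 + b1).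
  apply: ess_inf_npos_rises => //; congr (0 < ess_inf_npos _)%E : i2.
  by apply/funext => t; rewrite dot_vec2 /a1 /b1; ring.
have [m2 m20 M2] : exists2 c, 0 < c & rises (fun t => a2 * t - b2 * k2 t) c (b2 + a2).
  apply: ess_inf_nneg_rises => //; congr (0 < ess_inf_nneg _)%E : i3.
  by apply/funext => t; rewrite dot_vec2 /a2 /b2; ring.
have [n2 n20 N2] : exists2 c, 0 < c & rises (fun t => b2 * t + a2 * k1 (- t)) c (b2 + a2).
  apply: ess_inf_npos_rises => //; congr (0 < ess_inf_npos _)%E : i4.
  by apply/funext => t; rewrite dot_vec2 /a2 /b2; ring.
move=> [g [/andP[g0 _] SC]].
have k1c : convex1 k1 by case: k1u.
have k2c : convex1 k2 by case: k2u.
have a00' := ltW a00; have b00' := ltW b00; have a10' := ltW a10.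
have b10' := ltW b10; have a20' := ltW a20; have b20' := ltW b20; have g0' := ltW g0.
have G1 := rises_unit_slope k1u k10 a00' b00'.
have G2 := rises_unit_slope k2u k20 b00' a00'.
have [th1 g1 PQ] : exists2 th, gauge th (b0 / (a1 + b1)) ((a0 + b0) / m1) &
    forall t, 0 <= t -> th (b1 * t - a1 * k1 t) = a0 * k1 t + b0 * t.
  apply: gauge_exists G1 M1 _ _ _ _ _ _ => //; rewrite ?addr_gt0 //.
    exact: convex1_add_linear k1c a00' (fun=> erefl).
  by apply: (convex1_add_linear (B := - b1) k1c a10') => t; ring.
have [th2 g2 PR] : exists2 th, gauge th (a0 / (b2 + a2)) ((b0 + a0) / m2) &
    forall t, 0 <= t -> th (a2 * t - b2 * k2 t) = b0 * k2 t + a0 * t.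
  apply: gauge_exists G2 M2 _ _ _ _ _ _ => //; rewrite ?addr_gt0 //.
    exact: convex1_add_linear k2c b00' (fun=> erefl).
  by apply: (convex1_add_linear (B := - a2) k2c b20') => t; ring.
set c1 := b0 / _ in g1; set L1 := (a0 + b0) / m1 in g1.
set c2 := a0 / _ in g2; set L2 := (b0 + a0) / m2 in g2.
have c10 : 0 < c1 by rewrite divr_gt0 // addr_gt0.
have c20 : 0 < c2 by rewrite divr_gt0 // addr_gt0.
have L10 : 0 < L1 by rewrite divr_gt0 // addr_gt0.
have L20 : 0 < L2 by rewrite divr_gt0 // addr_gt0.
have thN1 := gauge_rises g1 (ltW c10) (ltW L10) N1 n10.
have thN2 := gauge_rises g2 (ltW c20) (ltW L20) N2 n20.
have [th3 g3 QS] : exists2 th,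
    gauge th (c1 * n1 / (g + 1)) (L1 * (a1 + b1) / 1) &
    forall t, 0 <= t -> th (t - g * k2 (- t)) = th1 (a1 * t + b1 * k2 (- t)).
  apply: gauge_exists thN1 (rises_reflect k2u k20 g0') _ _ _ _ _ _ => //.
  - by rewrite mulr_gt0.
  - by rewrite mulr_gt0 // addr_gt0.
  - by rewrite addr_gt0.
  - apply: (convex1_comp g1).
    by apply: (convex1_add_linear (B := a1) (convex1_opp k2c) b10') => t; ring.
  - by apply: (convex1_add_linear (B := - 1) (convex1_opp k2c) g0') => t; ring.
have [th4 g4 RS] : exists2 th,
    gauge th (c2 * n2 / (g + 1)) (L2 * (b2 + a2) / 1) &
    forall t, 0 <= t -> th (t - g * k1 (- t)) = th2 (b2 * t + a2 * k1 (- t)).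
  apply: gauge_exists thN2 (rises_reflect k1u k10 g0') _ _ _ _ _ _ => //.
  - by rewrite mulr_gt0.
  - by rewrite mulr_gt0 // addr_gt0.
  - by rewrite addr_gt0.
  - apply: (convex1_comp g2).
    by apply: (convex1_add_linear (B := b2) (convex1_opp k1c) a20') => t; ring.
  - by apply: (convex1_add_linear (B := - 1) (convex1_opp k1c) g0') => t; ring.
set c3 := c1 * n1 / _ in g3; set c4 := c2 * n2 / _ in g4.
set L3 := _ / 1 in g3; set L4 := L2 * _ / 1 in g4.
have c30 : 0 < c3 by apply: divr_gt0; [exact: mulr_gt0 | exact: addr_gt0].
have c40 : 0 < c4 by apply: divr_gt0; [exact: mulr_gt0 | exact: addr_gt0].
pose c := Num.min (Num.min c1 c2) (Num.min c3 c4).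
pose L := Num.max (Num.max L1 L2) (Num.max L3 L4).
have c0 : 0 < c by rewrite !lt_min c10 c20 c30 c40.
have L0 : 0 < L by rewrite !lt_max L10.
have {}g1 : gauge th1 c L.
  by apply: gauge_weaken g1 _ _; rewrite ?ge_min ?le_max lexx ?orbT.
have {}g2 : gauge th2 c L.
  by apply: gauge_weaken g2 _ _; rewrite ?ge_min ?le_max lexx ?orbT.
have {}g3 : gauge th3 c L.
  by apply: gauge_weaken g3 _ _; rewrite ?ge_min ?le_max lexx ?orbT.
have {}g4 : gauge th4 c L.
  by apply: gauge_weaken g4 _ _; rewrite ?ge_min ?le_max lexx ?orbT.
(* Two points of the lower half-curves at the same level are [xQS] and [xRS] for [lambda] equal to
   that level: following the lines of [v1] and [v2] back to the upper half-curves gives [p] and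
   [q]. *)
have matching s t : 0 <= s -> 0 <= t ->
    th1 (a1 * s + b1 * k2 (- s)) = th2 (b2 * t + a2 * k1 (- t)) ->
    0 < th1 (a1 * s + b1 * k2 (- s)) ->
    [/\ 0 < k1 (- t) + s, g * (k2 (- s) + t) <= k1 (- t) + s
      & g * (k1 (- t) + s) <= k2 (- s) + t].
  move=> s0 t0 st lam0.
  have [p p0 Mp] := rises_surj M1 m10 (rises_ge0 N1 n10 s0).
  have [q q0 Mq] := rises_surj M2 m20 (rises_ge0 N2 n20 t0).
  apply: (slope_condition_coord k1u k10 k2u k20 g0 (SC _ lam0) (p := p) (q := q)) => //.
  - by rewrite dot_vec2 -/a0 -/b0 -PQ // Mp.
  - by rewrite dot_vec2 -/a0 -/b0 addrC -PR // Mq st.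
  - rewrite !dot_vec2; have := Mp; rewrite /a1 /b1; lra.
  - rewrite !dot_vec2; have := Mq; rewrite /a2 /b2; lra.
have SL1 t : 0 <= t ->
    th1 (- (b1 * t) - a1 * k1 (- t)) <= th2 (a2 * k1 (- t) + b2 * t) /\
    th3 (- k1 (- t) + g * t) <= th2 (a2 * k1 (- t) + b2 * t).
  (* The slope condition concerns positive levels; at [t = 0] all forms vanish. *)
  rewrite le_eqVlt => /predU1P[<-|t0].
    by rewrite oppr0 k10 !mulr0 !addr0 oppr0 !(gauge_npos g1, gauge_npos g2, gauge_npos g3).
  have lam0 := rises_gt0 thN2 (mulr_gt0 c20 n20) t0.
  (* The point of parameter [s] on the other lower half-curve has the same level, and by the slope
     bounds the forms of [th1] and [th3] are at least as large there. *)
  have [s s0 sE] := rises_surj thN1 (mulr_gt0 c10 n10) (ltW lam0).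
  have [|d1' d2' d3'] := matching s t s0 (ltW t0) sE; first by rewrite [ltRHS]sE.
  rewrite (addrC (a2 * _)); move: sE => /= <-; split.
    apply: (gauge_le g1).
    have := ler_wpM2l a10' (ltW d1').
    have e0 : 0 <= k2 (- s) + t.
      by apply: le_trans d3'; rewrite mulr_ge0 // ltW.
    have := ler_wpM2l b10' e0; lra.
  by rewrite -QS //; apply: (gauge_le g3); lra.
have SL2 t : 0 <= t ->
    th2 (- (a2 * t) - b2 * k2 (- t)) <= th1 (b1 * k2 (- t) + a1 * t) /\
    th4 (- k2 (- t) + g * t) <= th1 (b1 * k2 (- t) + a1 * t).
  rewrite le_eqVlt => /predU1P[<-|t0].
    by rewrite oppr0 k20 !mulr0 !addr0 oppr0 !(gauge_npos g1, gauge_npos g2, gauge_npos g4).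
  have lam0 : 0 < th1 (a1 * t + b1 * k2 (- t)) := rises_gt0 thN1 (mulr_gt0 c10 n10) t0.
  have [s s0 sE] := rises_surj thN2 (mulr_gt0 c20 n20) (ltW lam0).
  have [//|d1' d2' d3'] := matching t s (ltW t0) s0 (esym sE).
  rewrite (addrC (b1 * _)); move: sE => /= <-; split.
    apply: (gauge_le g2).
    have := ler_wpM2l a20' (ltW d1').
    have e0 : 0 <= k2 (- t) + s.
      by apply: le_trans d3'; rewrite mulr_ge0 // ltW.
    have := ler_wpM2l b20' e0; lra.
  by rewrite -RS //; apply: (gauge_le g4); lra.
pose phi := potential a0 b0 a1 b1 a2 b2 g th1 th2 th3 th4.
(* [kap] is below every growth rate that occurs in either projection. *)
pose kap := Num.min (Num.min a0 b0) (c * Num.min (Num.min (Num.min a1 b1) (Num.min a2 b2)) g).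
pose K := a0 + b0 + L * (a1 + b1 + a2 + b2 + 1 + g).
have K0 : 0 < K by rewrite !addr_gt0 // mulr_gt0 // !addr_gt0.
have kap0 : 0 < kap by rewrite !lt_min a00 b00 mulr_gt0 // !lt_min a10 b10 a20 b20 g0.
have kc e : Num.min (Num.min (Num.min a1 b1) (Num.min a2 b2)) g <= e -> kap <= c * e.
  by move=> He; rewrite ge_min ler_pM2l // He orbT.
exists phi, kap, K; split => //.
  rewrite /phi /potential !mulr0 addr0 oppr0 !addr0.
  by rewrite !(gauge_npos g1, gauge_npos g2, gauge_npos g3, gauge_npos g4) // !maxxx.
split.
- move=> x y; have [_ + _ _ _] := le_potential a0 b0 a1 b1 a2 b2 g th1 th2 th3 th4 x y.
  by apply: le_trans; exact: (gauge_ge0 _ g1).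
- by move=> x y x' y'; apply: (@potential_lip _ _ _ _ _ _ _ _ c L); split=> //; exact: ltW.
- by move=> x y x' y'; apply: potential_midpoint; [case: g1|case: g2|case: g3|case: g4].
- apply: (potential_projection (L := L) k1u k10 k2u k20 _ b20 g0 c0); rewrite ?/kap //.
  + by move=> t t0; split; [exact: rises_ge0 M1 m10 t0 | exact: PQ].
  + by move=> t t0; rewrite PR // addrC.
  + move=> t t0; rewrite (addrC (a2 * _)); split; [exact: rises_ge0 N2 n20 t0 | exact: RS].
  + split; [by rewrite !ge_min lexx | | |]; apply: kc; rewrite !ge_min lexx ?orbT //.
(* The second curve follows by exchanging the coordinates. *)
- move=> x y; rewrite /phi !(potentialC a0 b0).
  apply: (potential_projection (L := L) k2u k20 k1u k10 _ a10 g0 c0); rewrite ?/kap //.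
  + by move=> t t0; split; [exact: rises_ge0 M2 m20 t0 | exact: PR].
  + by move=> t t0; rewrite PQ // addrC.
  + move=> t t0; rewrite (addrC (b1 * _)); split; [exact: rises_ge0 N1 n10 t0 | exact: QS].
  + split; [by rewrite !ge_min lexx ?orbT | | |]; apply: kc; rewrite !ge_min lexx ?orbT //.
Qed.

(** * The energy *)

Lemma max_norm2 (R : realType) (p : 'rV[R]_2) : `|p 0 0| + `|p 0 1| <= 2 * `|p|.
Proof. by rewrite row2_norm; case: (leP `|p 0 0| `|p 0 1|) => ?; lra. Qed.

Section energy.
Variables (R : realType) (phi : R -> R -> R) (kap K : R).
Hypotheses (kap0 : 0 < kap) (K0 : 0 < K) (phi00 : phi 0 0 = 0).
Hypothesis phi_ge0 : forall x y, 0 <= phi x y.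
Hypothesis phi_lip : forall x y x' y',
  phi x y <= phi x' y' + K * (`|x - x'| + `|y - y'|).
Hypothesis phi_mid : forall x y x' y',
  phi ((x + x') / 2) ((y + y') / 2) <= (phi x y + phi x' y') / 2.

(** Squaring gives at most quadratic growth and keeps convexity because [phi] is nonnegative; the
    second term makes the convexity strong. Its weight is tied to the growth rate of [phi] off the
    curves, as [energy_increase] requires. *)
Definition energy (p : 'rV[R]_2) : R :=
  phi (p 0 0) (p 0 1) ^+ 2 + kap ^+ 2 * dot p p.

Lemma energy_continuous : continuous energy.
Proof.
have phic : continuous (fun p : 'rV[R]_2 => phi (p 0 0) (p 0 1)).
  apply: (@lipschitz_bound_continuous R 'rV[R]_2 R _ (2 * K)) => p q.
  have H := max_norm2 (p - q).
  have := phi_lip (p 0 0) (p 0 1) (q 0 0) (q 0 1).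
  have := phi_lip (q 0 0) (q 0 1) (p 0 0) (p 0 1).
  rewrite (distrC (q 0 0)) (distrC (q 0 1)).
  move: H; rewrite !mxE => /(ler_wpM2l (ltW K0)) H H1 H2.
  by rewrite ler_norml; apply/andP; split; lra.
have dotc : continuous (fun p : 'rV[R]_2 => dot p p).
  have -> : (fun p : 'rV[R]_2 => dot p p) = fun p => p 0 0 * p 0 0 + p 0 1 * p 0 1.
    by apply/funext => p; exact: dotE.
  move=> p.
  have cc j : (fun h : 'rV[R]_2 => h 0 j) @ p --> p 0 j by apply: coord_continuous.
  exact: cvgD (cvgM (cc 0) (cc 0)) (cvgM (cc 1) (cc 1)).
have -> : energy = fun p => phi (p 0 0) (p 0 1) * phi (p 0 0) (p 0 1) +
    kap ^+ 2 * dot p p.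
  by apply/funext => p; rewrite /energy expr2.
move=> p; exact: cvgD (cvgM (@phic p) (@phic p)) (cvgMl_tmp (@dotc p)).
Qed.

Lemma energy_strong p q : energy (2^-1 *: (p + q)) <=
  (energy p + energy q) / 2 - kap ^+ 2 / 4 * dot (p - q) (p - q).
Proof.
rewrite /energy !mxE !dotE !mxE.
have := phi_mid (p 0 0) (p 0 1) (q 0 0) (q 0 1).
rewrite ![_ / 2]mulrC.
set A := phi _ _; set B := phi _ _; set D := phi _ _ => D_le.
have D0 : 0 <= A by exact: phi_ge0.
have : A ^+ 2 <= (B ^+ 2 + D ^+ 2) / 2.
  apply: (@le_trans _ _ ((2^-1 * (B + D)) ^+ 2)).
    by rewrite ler_pXn2r // nnegrE // mulr_ge0 ?invr_ge0 // addr_ge0 //; exact: phi_ge0.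
  have := sqr_ge0 (B - D); rewrite !expr2; lra.
rewrite !expr2; lra.
Qed.

Lemma energy_bounds p :
  kap ^+ 2 * dot p p <= energy p <= (2 * K ^+ 2 + kap ^+ 2) * dot p p.
Proof.
rewrite /energy lerDr sqr_ge0 /= [leRHS]mulrDl lerD2r.
have := phi_lip (p 0 0) (p 0 1) 0 0; rewrite phi00 !subr0 add0r => H.
apply: (@le_trans _ _ ((K * (`|p 0 0| + `|p 0 1|)) ^+ 2)).
  by rewrite ler_pXn2r // nnegrE // mulr_ge0 ?addr_ge0 // ltW.
have S2 : (`|p 0 0| + `|p 0 1|) ^+ 2 <= 2 * dot p p.
  rewrite dotE (mulr_self_norm (p 0 0)) (mulr_self_norm (p 0 1)).
  have := sqr_ge0 (`|p 0 0| - `|p 0 1|); rewrite !expr2; lra.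
by rewrite exprMn; have := ler_wpM2l (sqr_ge0 K) S2; lra.
Qed.

End energy.

(* The quadratic term may decrease towards the minimizer [q], but by less than
   the potential increases. *)
Lemma energy_increase (R : realType) (kap F G q x : R) : 0 < kap ->
  G + kap * `|x - q| <= F -> kap * `|q| <= G -> x != q ->
  G ^+ 2 + kap ^+ 2 * q ^+ 2 < F ^+ 2 + kap ^+ 2 * x ^+ 2.
Proof.
move=> kap0 FG Gq xq.
have d0 : 0 < `|x - q| by rewrite normr_gt0 subr_eq0.
set d := `|x - q| in FG d0.
have kq0 : 0 <= kap * `|q| by rewrite mulr_ge0 // ltW.
have kd0 : 0 < kap * d by rewrite mulr_gt0.
have F2 : (G + kap * d) ^+ 2 <= F ^+ 2.
  by rewrite ler_pXn2r // nnegrE; lra.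
(* Twice this inequality lets the cross term of the square pay for the possible loss in the
   quadratic term. *)
have Gd : kap * `|q| * (kap * d) <= G * (kap * d) by rewrite ler_wpM2r // ltW.
have xd : q ^+ 2 - x ^+ 2 <= 2 * `|q| * d - d ^+ 2.
  have dd : d ^+ 2 = (x - q) ^+ 2 by rewrite -normrX ger0_norm ?sqr_ge0.
  have : - (q * (x - q)) <= `|q| * d by rewrite -normrM -normrN ler_norm.
  rewrite dd !expr2; lra.
have k2 : 0 <= kap ^+ 2 by rewrite sqr_ge0.
have := ler_wpM2l k2 xd.
have : 0 < kap ^+ 2 * d ^+ 2 by rewrite mulr_gt0 // exprn_gt0.
move: F2 Gd; rewrite !expr2; lra.
Qed.

(** * Sign conditions and growth of the transform *)

Theorem corollary6p1 (R : realType) (h1 h2 : R -> R) (alpha1 alpha2 : R)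
    (h1P : convex_slope h1 alpha1) (h2P : convex_slope h2 alpha2)
    (a : 'rV[R]_2) (ha1 : h1 (a 0 1) = a 0 0) (ha2 : h2 (a 0 0) = a 0 1)
    (hv : exists v0 v1 v2 : 'rV[R]_2,
       admissible (htilde1 h1 a) (htilde2 h2 a) v0 v1 v2 /\
       slope_condition (htilde1 h1 a) (htilde2 h2 a) v0 v1 v2) :
  exists f : 'rV[R]_2 -> R,
    [/\ convex_function [set: 'rV[R]_2] f,
        C11 f,
        forall x : 'rV[R]_2,
          [/\ x 0 0 <= 0 -> 0 <= H1 h1 (grad f x),
              0 <= x 0 0 -> H1 h1 (grad f x) <= 0,
              x 0 1 <= 0 -> 0 <= H2 h2 (grad f x)
            & 0 <= x 0 1 -> H2 h2 (grad f x) <= 0]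
      & exists delta C : R,
          [/\ 0 < delta, 0 < C
            & forall x : 'rV[R]_2,
                delta * dot x x - C <= f x <= C * (dot x x + 1)]].
Proof.
have [v0 [v1 [v2 [adm SC]]]] := hv.
set k1 := htilde1 h1 a in adm SC; set k2 := htilde2 h2 a in adm SC.
have k1u : unit_slope k1 by exact: unit_slope_shift (convex_slope_unit_slope h1P).
have k2u : unit_slope k2 by exact: unit_slope_shift (convex_slope_unit_slope h2P).
have k10 : k1 0 = 0 by rewrite /k1 /htilde1 add0r ha1 addNr.
have k20 : k2 0 = 0 by rewrite /k2 /htilde2 add0r ha2 addNr.
have k1d : {ae @lebesgue_measure R, forall t, derivable k1 t 1}.
  exact: convex_slope_ae_derivable h1P.
have k2d : {ae @lebesgue_measure R, forall t, derivable k2 t 1}.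
  exact: convex_slope_ae_derivable h2P.
have [phi [kap [K [kap0 K0 phi00 [phi_ge0 phi_lip phi_mid proj1 proj2]]]]] :=
  potential_exists k1u k10 k2u k20 k1d k2d adm SC.
have d0 : 0 < kap ^+ 2 by rewrite exprn_gt0.
have C0 : 0 < 2 * K ^+ 2 + kap ^+ 2 by rewrite addr_gt0 // mulr_gt0 // exprn_gt0.
set C := 2 * _ + _ in C0.
have Ec : continuous (energy phi kap) by exact: energy_continuous phi_lip.
have Es := energy_strong kap phi_ge0 phi_mid.
have Eb := energy_bounds kap K0 phi00 phi_ge0 phi_lip.
pose P := legendre_grad d0 Ec Eb.
pose F := legendre d0 Ec Eb.
(* The linear term moves the gradient by [a], undoing the passage from [h1], [h2] to [k1], [k2]. *)
pose f x := F x + dot a x.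
have [fd gradf] : (forall x, differentiable f x) /\ forall x, grad f x = P x + a.
  suff H x : differentiable f x /\ grad f x = P x + a by split=> x; case: (H x).
  apply: (@quadratic_expansion_diff _ _ _ _ (2 * kap ^+ 2)^-1) => h.
  have := legendre_expansion d0 Ec Es Eb x h; congr (`|_| <= _).
  by rewrite /f /F -/P !dotE !mxE; ring.
have gradE : grad f = fun x => P x + a by apply/funext.
have gradL x y : `|grad f x - grad f y| <= 2 / kap ^+ 2 * `|x - y|.
  rewrite gradE opprD addrACA subrr addr0.
  exact: legendre_grad_lip_norm.
have Pmin x p : dot x p - energy phi kap p <= dot x (P x) - energy phi kap (P x).
  exact: legendre_ge.
exists f; split.
- move=> t x y _ _.
  have := @legendre_convex _ _ _ _ d0 Ec Eb t x y; rewrite !inE => /(_ I I).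
  rewrite !convRE /f -/F.
  have -> : conv t x y = t%:num *: x + (1 - t%:num) *: y by [].
  rewrite !dotE !mxE /unstable.onem; lra.
- split=> //; first exact: lipschitz_bound_continuous gradL.
  have PF : ProperFilter (globally ([set: 'rV[R]_2] `*` [set: 'rV[R]_2])).
    exact: (@globally_properfilter _ _ (0, 0)).
  by apply: (@klipschitzW _ _ _ (2 / kap ^+ 2)) => -[x y] _ /=; exact: gradL.
- move=> x; rewrite gradf /H1 /H2 !mxE.
  set p := P x.
  have H1E : - (p 0 0 + a 0 0) + h1 (p 0 1 + a 0 1) = k1 (p 0 1) - p 0 0.
    by rewrite /k1 /htilde1; ring.
  have H2E : - (p 0 1 + a 0 1) + h2 (p 0 0 + a 0 0) = k2 (p 0 0) - p 0 1.
    by rewrite /k2 /htilde2; ring.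
  (* The competitor on the curve has strictly smaller energy, so maximality of [p] forces a strict
     inequality between the linear terms. *)
  have min1 : p 0 0 != k1 (p 0 1) -> x 0 0 * (k1 (p 0 1)) < x 0 0 * p 0 0.
    move=> /(energy_increase kap0 (proj1 _ _).1 (proj1 (p 0 0) _).2).
    have := Pmin x (vec2 (k1 (p 0 1)) (p 0 1)).
    rewrite -/p /energy !dotE !mxE /= !expr2; lra.
  have min2 : p 0 1 != k2 (p 0 0) -> x 0 1 * (k2 (p 0 0)) < x 0 1 * p 0 1.
    move=> /(energy_increase kap0 (proj2 _ _).1 (proj2 _ (p 0 1)).2).
    have := Pmin x (vec2 (p 0 0) (k2 (p 0 0))).
    rewrite -/p /energy !dotE !mxE /= !expr2; lra.
  (* A wrong sign of [H1] or [H2] would make that strict inequality contradict the sign of the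
     coordinate of [x]. *)
  rewrite H1E H2E !subr_ge0 !subr_le0; split=> x0; rewrite leNgt; apply/negP => lt;
    [have := min1 _ | have := min1 _ | have := min2 _ | have := min2 _];
    rewrite ?(lt_eqF lt) ?(gt_eqF lt) => /(_ isT); apply/negP; rewrite -leNgt.
  + by rewrite ler_wnM2l // ltW.
  + by rewrite ler_wpM2l // ltW.
  + by rewrite ler_wnM2l // ltW.
  + by rewrite ler_wpM2l // ltW.
- set A := dot a a; have A0 : 0 <= A := dot_self_ge0 a.
  (* Half of the coercivity constant [(4 * C)^-1] absorbs the linear term by completing the square,
     at the cost [2 * C * A]. *)
  exists ((8 * C)^-1), ((4 * kap ^+ 2)^-1 + 1 + A + 2 * C * A).
  have i1 : 0 < (4 * kap ^+ 2)^-1 by rewrite invr_gt0 mulr_gt0.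
  have CA : 0 <= 2 * C * A by rewrite !mulr_ge0 // ltW.
  split=> [||x]; [by rewrite invr_gt0 mulr_gt0 | by lra |].
  have X0 := dot_self_ge0 x.
  have lo := legendre_coercive d0 C0 Ec Eb x; have up := legendre_le d0 Ec Eb x.
  rewrite -/(F x) in lo up.
  have ax1 : - ((8 * C)^-1 * dot x x) - 2 * C * A <= dot a x.
    have := mulr_ge0 (ltW (_ : 0 < (8 * C)^-1)) (dot_self_ge0 (x + (4 * C) *: a)).
    rewrite invr_gt0 mulr_gt0 // => /(_ isT).
    have -> : (8 * C)^-1 * dot (x + (4 * C) *: a) (x + (4 * C) *: a) =
       (8 * C)^-1 * dot x x + dot a x + 2 * C * A.
      by rewrite /A !dotE !mxE; field; rewrite gt_eqF.
    lra.
  have ax2 : dot a x <= dot x x + A.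
    have := dot_self_ge0 (x - a).
    have -> : dot (x - a) (x - a) = dot x x + A - 2 * dot a x.
      by rewrite /A !dotE !mxE; ring.
    lra.
  have CC : (4 * C)^-1 = 2 * (8 * C)^-1 by field; rewrite gt_eqF.
  rewrite CC in lo; rewrite /f; apply/andP; split; first by lra.
  have := mulr_ge0 A0 X0; have := mulr_ge0 CA X0; lra.
Qed.
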